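(* Let $l$ be a prime, $E$ an elliptic curve defined over a field $K$ with $\operatorname{char} K\nmid l$, and $P\in E(K)$. Then at least one of the following holds: (i) $\delta_l^P$ is irreducible over $K$; (ii) $E$ admits an isogeny of degree $l$ to another elliptic curve, defined over $K$ (equivalently, $E$ has a cyclic subgroup of order $l$ stable under $\operatorname{Gal}(\bar K/K)$); (iii) there exists $Q\in E(K)$ with $lQ=P$.
   Context: For an elliptic curve $E$ over a field $K$ with Weierstrass coordinate functions $x,y$ and $m\in\mathbb{Z}$, $\psi_m$ denotes the $m$-th division polynomial, so that $\psi_m^2\in K[x]$, and $\theta_m=x\psi_m^2-\psi_{m+1}\psi_{m-1}\in K[x]$, so that $x([m]R)=\theta_m(x(R))/\psi_m^2(x(R))$. For $P\in E(K)$, $\delta_m^P=\theta_m-x(P)\psi_m^2$ if $P\ne O$ and $\delta_m^P=\psi_m^2$ if $P=O$. *)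

(* Defs.v *)
From HB Require Import structures.
From mathcomp Require Import all_boot all_order all_algebra all_field.
Set Implicit Arguments. Unset Strict Implicit. Unset Printing Implicit Defensive.
Import GRing.Theory.
Local Open Scope ring_scope.

Record wcurve (K : Type) := WCurve { wa1 : K; wa2 : K; wa3 : K; wa4 : K; wa6 : K }.

Section Curve.
Variable K : fieldType.
Variable E : wcurve K.
Local Notation a1 := (wa1 E). Local Notation a2 := (wa2 E).
Local Notation a3 := (wa3 E). Local Notation a4 := (wa4 E).
Local Notation a6 := (wa6 E).

Definition wb2 : K := a1 ^+ 2 + 4%:R * a2.
Definition wb4 : K := 2%:R * a4 + a1 * a3.
Definition wb6 : K := a3 ^+ 2 + 4%:R * a6.
Definition wb8 : K := a1 ^+ 2 * a6 + 4%:R * a2 * a6 - a1 * a3 * a4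
                      + a2 * a3 ^+ 2 - a4 ^+ 2.
Definition wdisc : K := - wb2 ^+ 2 * wb8 - 8%:R * wb4 ^+ 3 - 27%:R * wb6 ^+ 2
                        + 9%:R * wb2 * wb4 * wb6.

Definition is_elliptic : bool := wdisc != 0.

(* Points of E over K: None is the point at infinity O. *)
Definition pt := option (K * K).

Definition on_curve (P : pt) : bool :=
  if P is Some (x, y) then
    y ^+ 2 + a1 * x * y + a3 * y == x ^+ 3 + a2 * x ^+ 2 + a4 * x + a6
  else true.

(* Group law (Silverman, AEC, III.2.3). *)
Definition addpt (P Q : pt) : pt :=
  match P, Q with
  | None, _ => Q
  | _, None => P
  | Some (x1, y1), Some (x2, y2) =>
    if (x1 == x2) && (y1 + y2 + a1 * x2 + a3 == 0) then None else
    let lam_nu :=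
      if x1 == x2 then
        ((3%:R * x1 ^+ 2 + 2%:R * a2 * x1 + a4 - a1 * y1) / (2%:R * y1 + a1 * x1 + a3),
         (- x1 ^+ 3 + a4 * x1 + 2%:R * a6 - a3 * y1) / (2%:R * y1 + a1 * x1 + a3))
      else ((y2 - y1) / (x2 - x1), (y1 * x2 - y2 * x1) / (x2 - x1)) in
    let lam := lam_nu.1 in let nu := lam_nu.2 in
    let x3 := lam ^+ 2 + a1 * lam - a2 - x1 - x2 in
    Some (x3, - (lam + a1) * x3 - nu - a3)
  end.

Definition mulpt (n : nat) (P : pt) : pt := iter n (addpt P) None.

(* Division polynomials.  F = psi_2^2 = 4x^3 + b2 x^2 + 2 b4 x + b6.
   dpf n is the polynomial f_n in K[x] with psi_n = f_n (n odd) and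
   psi_n = psi_2 * f_n (n even), where psi_2 = 2y + a1 x + a3. *)
Definition dpF : {poly K} :=
  4%:R *: 'X ^+ 3 + wb2 *: 'X ^+ 2 + (2%:R * wb4) *: 'X + wb6%:P.
Definition dpf3 : {poly K} :=
  3%:R *: 'X ^+ 4 + wb2 *: 'X ^+ 3 + (3%:R * wb4) *: 'X ^+ 2
  + (3%:R * wb6) *: 'X + wb8%:P.
Definition dpf4 : {poly K} :=
  2%:R *: 'X ^+ 6 + wb2 *: 'X ^+ 5 + (5%:R * wb4) *: 'X ^+ 4
  + (10%:R * wb6) *: 'X ^+ 3 + (10%:R * wb8) *: 'X ^+ 2
  + (wb2 * wb8 - wb4 * wb6) *: 'X + (wb4 * wb8 - wb6 ^+ 2)%:P.

Fixpoint dpf_fuel (fuel n : nat) {struct fuel} : {poly K} :=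
  match fuel with
  | 0%N => 0
  | fuel'.+1 =>
    let g := dpf_fuel fuel' in
    match n with
    | 0%N => 0 | 1%N => 1 | 2%N => 1 | 3%N => dpf3 | 4%N => dpf4
    | _ =>
      let m := n./2 in
      if odd n then
        (if odd m then
           g (m + 2)%N * g m ^+ 3 - dpF ^+ 2 * g (m - 1)%N * g (m + 1)%N ^+ 3
         else
           dpF ^+ 2 * g (m + 2)%N * g m ^+ 3 - g (m - 1)%N * g (m + 1)%N ^+ 3)
      else g m * (g (m + 2)%N * g (m - 1)%N ^+ 2 - g (m - 2)%N * g (m + 1)%N ^+ 2)
    end
  end.

Definition dpf (n : nat) : {poly K} := dpf_fuel n.+1 n.

Definition psi_sq (n : nat) : {poly K} :=
  if odd n then dpf n ^+ 2 else dpF * dpf n ^+ 2.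

(* psi_{n+1} psi_{n-1} in K[x], for n >= 1 *)
Definition psi_nb (n : nat) : {poly K} :=
  if odd n then dpF * dpf n.+1 * dpf n.-1 else dpf n.+1 * dpf n.-1.

Definition theta (n : nat) : {poly K} := 'X * psi_sq n - psi_nb n.

Definition delta (n : nat) (P : pt) : {poly K} :=
  if P is Some (xP, _) then theta n - xP *: psi_sq n else psi_sq n.

End Curve.

Definition wc_map (K L : Type) (f : K -> L) (E : wcurve K) : wcurve L :=
  WCurve (f (wa1 E)) (f (wa2 E)) (f (wa3 E)) (f (wa4 E)) (f (wa6 E)).

Definition map_pt (L : Type) (f : L -> L) (Q : option (L * L)) : option (L * L) :=
  omap (fun p => (f p.1, f p.2)) Q.

(* E admits a K-rational cyclic subgroup of order l stable under
   Gal(Kbar/K): realised inside a finite normal extension L of K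
   (a splittingFieldType over K) as a point Q of order l whose cyclic
   group <Q> is stable under all K-automorphisms of L. *)
Definition has_gal_stable_cyclic (K : fieldType) (E : wcurve K) (l : nat) : Prop :=
  exists (L : splittingFieldType K) (Q : pt L),
    let EL := wc_map (in_alg L) E in
    [/\ on_curve EL Q, Q != None, mulpt EL l Q = None &
        forall s : gal_of (fullv : {vspace L}),
          exists k : nat, map_pt s Q = mulpt EL k Q].

(* Main.v *)
Require Import Defs.
From HB Require Import structures.
From Stdlib Require Import Classical.
From mathcomp Require Import all_boot all_order all_algebra all_fingroup.
From mathcomp Require Import all_solvable all_field ring zify.
Set Implicit Arguments. Unset Strict Implicit. Unset Printing Implicit Defensive.
Import GRing.Theory.
Local Open Scope ring_scope.

(** The solutions of [l R = P] form a torsor under the plane [V = E[l]] over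
    F_l, on which the Galois group [G] acts by affine maps.  If [P <> - P], the
    coordinate [x] is injective on this torsor, and its values are the [l ^ 2]
    roots of [delta].  Assume that [V] has no [G]-stable line.  If the kernel of
    the action on [V] moves a solution, it does so by translations, which then
    fill up [V], so [G] is transitive and [delta] is irreducible.  Otherwise [G]
    fixes a solution: if [l] does not divide the size of an orbit, its
    barycentre; else [G] contains a transvection of [V], a conjugate with
    another axis, hence an element acting as [-1], whose only fixed point is
    fixed by [G] (for [l = 2], an orbit of size 2 would give a stable line).

    The group law is associative because sending [P] to the class of the ideal
    [(X - x, Y - y)] of the coordinate ring is injective and additive.  The
    division polynomials satisfy the Somos-4 relation, so that [theta / psi ^ 2]
    for [n + 1] and [n - 1] has the same symmetric functions as the [x]-coordinates of
    [n R + R] and [n R - R]; hence [x (n R) = theta / psi ^ 2] at every point,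
    torsion or not.  Finally [V] has [l ^ 2] elements since the Wronskian of
    [theta] and [psi ^ 2] has leading coefficient [l ^ 2], so that a generic
    fibre of [theta / psi ^ 2] is separable. *)

(** * Finitely generated ideals up to principal factors *)

(** When [P = - P], [x] is no longer injective on the solutions, and the theorem is elementary: [O]
    is its own multiple, and a point of order 2 equals its [l]-th multiple for odd [l] and spans a
    rational subgroup for [l = 2].

    The multiplication formula and the nonvanishing of division polynomials depend on each other.
    The Somos relations are proved by dividing by earlier terms, while [dpf E n != 0] cannot be read
    off a leading coefficient, which vanishes when the characteristic divides it. Both come from one
    induction on [n], over all fields at once, since it passes to extensions to find roots and
    points.

    No algebraic closure is available: points are constructed in successive extensions, then brought
    back to one normal extension [L] because their coordinates are roots of a polynomial over [K]
    that splits in [L]. As [L] may be inseparable over [K], a Galois-invariant element is only known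
    to be rational once it is a root of a polynomial over [K] with simple roots. *)

Section Ideals.
Variable R : comNzRingType.
Implicit Types (s t u : seq R) (a b z : R).

(** Ideals are kept as lists of generators, with one coefficient chosen at a time, so that products
    are explicit lists and inclusions are checked on generators. *)
Fixpoint idl s z : Prop :=
  if s is g :: s' then exists c, idl s' (z - c * g) else z = 0.

Lemma idl0 s : idl s 0.
Proof. by elim: s => [|g s IH] //=; exists 0; rewrite mul0r subr0. Qed.

Lemma idlD s a b : idl s a -> idl s b -> idl s (a + b).
Proof.
elim: s a b => [|g s IH] a b /= => [-> ->|[c Hc] [d Hd]]; first exact: addr0.
exists (c + d); have -> : a + b - (c + d) * g = (a - c * g) + (b - d * g) by ring.
exact: IH.
Qed.

Lemma idlM s a b : idl s b -> idl s (a * b).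
Proof.
elim: s a b => [|g s IH] a b /= => [->|[c Hc]]; first exact: mulr0.
exists (a * c); have -> : a * b - a * c * g = a * (b - c * g) by ring.
exact: IH.
Qed.

Lemma idlN s a : idl s a -> idl s (- a).
Proof. by rewrite -mulN1r; apply: idlM. Qed.

Lemma idlB s a b : idl s a -> idl s b -> idl s (a - b).
Proof. by move=> Ha Hb; apply: idlD => //; apply: idlN. Qed.

Lemma idl_gen s g : g \in s -> idl s g.
Proof.
elim: s => [|h s IH] //=; rewrite inE => /orP[/eqP <-|/IH Hg].
  by exists 1; rewrite mul1r subrr; apply: idl0.
by exists 0; rewrite mul0r subr0.
Qed.

Definition sub_idl s t := forall z, idl s z -> idl t z.

Lemma sub_idlP s t : (forall g, g \in s -> idl t g) -> sub_idl s t.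
Proof.
elim: s => [|g s IH] Hs z /= => [->|[c Hc]]; first exact: idl0.
have -> : z = (z - c * g) + c * g by ring.
apply: idlD; last by apply: idlM; apply: Hs; rewrite mem_head.
by apply: IH Hc => h hs; apply: Hs; rewrite inE hs orbT.
Qed.

Definition pmul s t : seq R := [seq a * b | a <- s, b <- t].


(** Induction over an ideal; [Q] may be any ideal-like predicate, such as vanishing at a point, with
    no generators at hand. *)
Lemma idl_stable (Q : R -> Prop) s :
  Q 0 -> (forall a b, Q a -> Q b -> Q (a + b)) -> (forall a b, Q b -> Q (a * b)) ->
  (forall g, g \in s -> Q g) -> forall z, idl s z -> Q z.
Proof.
move=> Q0 QD QM; elim: s => [|g s IH] Hs z /= => [->|[c Hc]] //.
have -> : z = (z - c * g) + c * g by ring.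
apply: QD; last by apply: QM; apply: Hs; rewrite mem_head.
by apply: IH Hc => h hs; apply: Hs; rewrite inE hs orbT.
Qed.

Lemma idl_pmul s t a b : idl s a -> idl t b -> idl (pmul s t) (a * b).
Proof.
move=> Ha Hb; move: a Ha; apply: idl_stable.
- by rewrite mul0r; apply: idl0.
- by move=> a a'; rewrite mulrDl; apply: idlD.
- by move=> a a' H; rewrite -mulrA; apply: idlM.
move=> g gs; move: b Hb; apply: idl_stable.
- by rewrite mulr0; apply: idl0.
- by move=> a a'; rewrite mulrDr; apply: idlD.
- by move=> a a' H; rewrite mulrCA; apply: idlM.
by move=> h ht; apply: idl_gen; apply: allpairs_f.
Qed.

Lemma pmul_sub s t (Q : R -> Prop) :
  Q 0 -> (forall a b, Q a -> Q b -> Q (a + b)) -> (forall a b, Q b -> Q (a * b)) ->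
  (forall a b, idl s a -> idl t b -> Q (a * b)) ->
  forall z, idl (pmul s t) z -> Q z.
Proof.
move=> Q0 QD QM HQ; apply: idl_stable => // g /allpairsP[[a b] [/= Ha Hb ->]].
by apply: HQ; apply: idl_gen.
Qed.

Definition eqv s t := sub_idl s t /\ sub_idl t s.

Lemma eqv_refl s : eqv s s. Proof. by split. Qed.
Lemma eqv_sym s t : eqv s t -> eqv t s. Proof. by case. Qed.
Lemma eqv_trans s t u : eqv s t -> eqv t u -> eqv s u.
Proof. by case=> A B [C D]; split=> z /=; auto. Qed.

Lemma sub_pmul s s' t t' : sub_idl s s' -> sub_idl t t' ->
  sub_idl (pmul s t) (pmul s' t').
Proof.
move=> Hs Ht; apply: pmul_sub; [exact: idl0|exact: idlD|exact: idlM|].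
by move=> a b Ha Hb; apply: idl_pmul; auto.
Qed.

Lemma eqv_pmul s s' t t' : eqv s s' -> eqv t t' -> eqv (pmul s t) (pmul s' t').
Proof. by case=> A B [C D]; split; apply: sub_pmul. Qed.

Lemma sub_pmulC s t : sub_idl (pmul s t) (pmul t s).
Proof.
apply: pmul_sub; [exact: idl0|exact: idlD|exact: idlM|].
by move=> a b Ha Hb; rewrite mulrC; apply: idl_pmul.
Qed.

Lemma pmulC s t : eqv (pmul s t) (pmul t s).
Proof. by split; apply: sub_pmulC. Qed.

Lemma sub_pmulA s t u : sub_idl (pmul (pmul s t) u) (pmul s (pmul t u)).
Proof.
apply: pmul_sub; [exact: idl0|exact: idlD|exact: idlM|].
move=> a b Ha Hb; move: a Ha; apply: pmul_sub.
- by rewrite mul0r; apply: idl0.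
- by move=> a a'; rewrite mulrDl; apply: idlD.
- by move=> a a' H; rewrite -mulrA; apply: idlM.
by move=> a a' Ha Ha'; rewrite -mulrA; do !apply: idl_pmul.
Qed.

Lemma pmulA s t u : eqv (pmul (pmul s t) u) (pmul s (pmul t u)).
Proof.
split; first exact: sub_pmulA.
by move=> z /sub_pmulC /sub_pmulA /sub_pmulC /sub_pmulA /sub_pmulC.
Qed.

Lemma idl1 a z : idl [:: a] z <-> exists c, z = c * a.
Proof.
split=> [[c /= H]|[c ->]]; exists c; first by apply/eqP; rewrite -subr_eq0 H.
by rewrite subrr.
Qed.

Lemma idl_head a : idl [:: a] a.
Proof. by apply/idl1; exists 1; rewrite mul1r. Qed.

Lemma pmul1 s : eqv (pmul [:: 1] s) s.
Proof.
split.
  apply: pmul_sub; [exact: idl0|exact: idlD|exact: idlM|].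
  by move=> a b _; apply: idlM.
by move=> z Hz; rewrite -[z]mul1r; apply: idl_pmul => //; apply: idl_gen; rewrite mem_head.
Qed.

Lemma pmul11 a b : eqv (pmul [:: a] [:: b]) [:: a * b].
Proof. exact: eqv_refl. Qed.

Definition zero_free := forall a b, a != 0 -> b != 0 -> a * b != 0 :> R.
Hypothesis dom : zero_free.

(** Equality in the ideal class group, with denominators cleared so that fractional ideals are
    avoided. *)
Definition same_class s t := exists f g, [/\ f != 0, g != 0 & eqv (pmul [:: f] s) (pmul [:: g] t)].

Lemma eqv_class s t : eqv s t -> same_class s t.
Proof.
by move=> H; exists 1, 1; split; rewrite ?oner_neq0 //; apply: eqv_pmul => //; apply: eqv_refl.
Qed.

Lemma class_sym s t : same_class s t -> same_class t s.
Proof. by case=> f [g [Hf Hg H]]; exists g, f; split=> //; apply: eqv_sym. Qed.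

Lemma class_trans s t u : same_class s t -> same_class t u -> same_class s u.
Proof.
case=> f [g [Hf Hg H]] [f' [g' [Hf' Hg' H']]].
exists (f' * f), (g * g'); split; try exact: dom.
apply: eqv_trans (eqv_pmul (eqv_sym (pmul11 _ _)) (eqv_refl s)) _.
apply: eqv_trans (pmulA _ _ _) _.
apply: eqv_trans (eqv_pmul (eqv_refl _) H) _.
apply: eqv_trans (eqv_sym (pmulA _ _ _)) _.
apply: eqv_trans (eqv_pmul (pmulC _ _) (eqv_refl _)) _.
apply: eqv_trans (pmulA _ _ _) _.
apply: eqv_trans (eqv_pmul (eqv_refl _) H') _.
exact: eqv_sym (pmulA _ _ _).
Qed.

Lemma class_pmul s t u : same_class s t -> same_class (pmul s u) (pmul t u).
Proof.
case=> f [g [Hf Hg H]]; exists f, g; split=> //.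
apply: eqv_trans (eqv_sym (pmulA _ _ _)) _.
apply: eqv_trans (eqv_pmul H (eqv_refl u)) _.
exact: pmulA.
Qed.

Lemma class_pmulr s t u : same_class s t -> same_class (pmul u s) (pmul u t).
Proof.
move=> H; apply: class_trans (eqv_class (pmulC u s)) _.
by apply: class_trans (class_pmul u H) (eqv_class (pmulC t u)).
Qed.

Lemma principal_class a : a != 0 -> same_class [:: a] [:: 1].
Proof.
move=> Ha; exists 1, a; split=> //; first exact: oner_neq0.
exact: pmulC.
Qed.

End Ideals.

(** * The coordinate ring *)

Definition crd (K : fieldType) (E : wcurve K) : Type := ({poly K} * {poly K})%type.

Lemma sizeM (K : fieldType) (p q : {poly K}) :
  p != 0 -> q != 0 -> size (p * q) = (size p + size q).-1.
Proof. exact: size_mul. Qed.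

Lemma sizeP (K : fieldType) (p : {poly K}) : (0 < size p)%N = (p != 0).
Proof. exact: size_poly_gt0. Qed.

Section CoordinateRing.
Variables (K : fieldType) (E : wcurve K).
Local Notation a1 := (wa1 E). Local Notation a2 := (wa2 E).
Local Notation a3 := (wa3 E). Local Notation a4 := (wa4 E).
Local Notation a6 := (wa6 E).
Local Notation R := (crd E).
HB.instance Definition _ := GRing.Zmodule.copy R ({poly K} * {poly K})%type.

Definition crd_f : {poly K} := 'X^3 + a2 *: 'X^2 + a4 *: 'X + a6%:P.
Definition crd_h : {poly K} := a1 *: 'X + a3%:P.

(* [(a, b)] stands for [a + b y], where [y ^ 2 = crd_f - crd_h * y]. *)
Definition crd_mul (u v : R) : R :=
  (u.1 * v.1 + u.2 * v.2 * crd_f, u.1 * v.2 + u.2 * v.1 - u.2 * v.2 * crd_h).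
Definition crd_one : R := (1, 0).

Lemma crd_mulC : commutative crd_mul.
Proof. by move=> [a b] [c d]; congr (_, _); rewrite /=; ring. Qed.
Lemma crd_mulA : associative crd_mul.
Proof. by move=> [a b] [c d] [e f]; congr (_, _); rewrite /=; ring. Qed.
Lemma crd_mul1 : left_id crd_one crd_mul.
Proof. by move=> [a b]; congr (_, _); rewrite /=; ring. Qed.
Lemma crd_mulD : left_distributive crd_mul +%R.
Proof. by move=> [a b] [c d] [e f]; congr (_, _); rewrite /=; ring. Qed.
Lemma crd_one_neq0 : crd_one != 0.
Proof. by rewrite xpair_eqE oner_eq0. Qed.

HB.instance Definition _ := GRing.Zmodule_isComNzRing.Build R
  crd_mulA crd_mulC crd_mul1 crd_mulD crd_one_neq0.

(** The product of [a + b y] with its conjugate, in which [y] becomes [- y - crd_h]. *)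
Definition crd_norm (u : R) : {poly K} := u.1 ^+ 2 - u.1 * u.2 * crd_h - u.2 ^+ 2 * crd_f.

Lemma crd_normM u v : crd_norm (u * v) = crd_norm u * crd_norm v.
Proof. by case: u v => [a b] [c d]; rewrite /crd_norm /=; ring. Qed.

Lemma size_crd_f : size crd_f = 4%N.
Proof.
rewrite /crd_f -!addrA size_polyDl ?size_polyXn //.
rewrite (leq_ltn_trans (size_polyD _ _)) // gtn_max.
rewrite (leq_ltn_trans (size_scale_leq _ _)) ?size_polyXn //=.
rewrite (leq_ltn_trans (size_polyD _ _)) // gtn_max.
rewrite (leq_ltn_trans (size_scale_leq _ _)) ?size_polyX //=.
by rewrite (leq_ltn_trans (size_polyC_leq1 _)).
Qed.

Lemma size_crd_h : (size crd_h <= 2)%N.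
Proof.
by rewrite (leq_trans (size_polyD _ _)) // geq_max
  (leq_trans (size_scale_leq _ _)) ?size_polyX //= (leq_trans (size_polyC_leq1 _)).
Qed.

(** The degree of [a ^ 2] is even and that of [b ^ 2 * crd_f] is odd, so they cannot cancel, and the
    cross term has smaller degree than the larger one. *)
Lemma size_crd_norm (u : R) m n : size u.1 = m -> size u.2 = n.+1 ->
  size (crd_norm u) = maxn (2 * m - 1)%N (2 * n + 4)%N.
Proof.
case: u => a b /= Em En; rewrite /crd_norm /=.
have nb : b != 0 by rewrite -sizeP En.
have f0 : crd_f != 0 by rewrite -sizeP size_crd_f.
have sb : size (b ^+ 2 * crd_f) = (2 * n + 4)%N.
  by rewrite sizeM ?expf_neq0 // size_crd_f expr2 sizeM // En; lia.
have [a0|na] := eqVneq a 0.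
  move: Em; rewrite a0 size_poly0 => <-.
  by rewrite expr0n !mul0r !sub0r /= oppr0 add0r size_polyN sb muln0 max0n.
have m0 : (0 < m)%N by rewrite -Em sizeP.
have sa : size (a ^+ 2) = (2 * m - 1)%N by rewrite expr2 sizeM // Em; lia.
have sh : (size (a * b * crd_h)%R <= m + n.+1)%N.
  apply: leq_trans (size_polyMleq _ _) _; rewrite sizeM // Em En.
  by have := size_crd_h; lia.
have [lt|ge] := ltnP (n + 2) m.
  rewrite -addrA size_polyDl; first by rewrite sa; lia.
  rewrite -opprD size_polyN sa (leq_ltn_trans (size_polyD _ _)) // gtn_max sb.
  by apply/andP; split; [apply: leq_ltn_trans sh _|]; lia.
rewrite addrC size_polyDl size_polyN sb; first by lia.
rewrite (leq_ltn_trans (size_polyD _ _)) // size_polyN gtn_max sa.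
by apply/andP; split; [|apply: leq_ltn_trans sh _]; lia.
Qed.

Lemma size_crd_norm_x (u : R) m : size u.1 = m -> u.2 = 0 ->
  size (crd_norm u) = (2 * m - 1)%N.
Proof.
move=> Em b0; rewrite /crd_norm b0 expr0n mulr0 !mul0r !subr0 expr2.
have [a0|na] := eqVneq u.1 0.
  by move: Em; rewrite a0 mul0r size_poly0 => <-.
by rewrite sizeM // Em; lia.
Qed.

Lemma crd_norm_eq0 u : (crd_norm u == 0) = (u == 0).
Proof.
have [/= ->|nu] := eqVneq u 0.
  by rewrite /crd_norm /= expr0n !mul0r !subr0 eqxx.
apply/negbTE; case En: (size u.2) => [|n].
  have b0 : u.2 = 0 by apply/eqP; rewrite -size_poly_eq0 En.
  rewrite /crd_norm b0 expr0n mulr0 !mul0r !subr0 expf_neq0 //.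
  by apply: contra nu => /eqP a0; rewrite [u]surjective_pairing a0 b0.
by rewrite -sizeP (size_crd_norm erefl En); lia.
Qed.

(** The degree of the norm is the pole order at infinity. That it is never 1 reflects the genus, and
    it is what prevents the ideal of a point from being principal. *)
Lemma size_crd_norm_neq2 u : size (crd_norm u) != 2%N.
Proof.
case En: (size u.2) => [|n]; last by rewrite (size_crd_norm erefl En); lia.
have b0 : u.2 = 0 by apply/eqP; rewrite -size_poly_eq0 En.
by rewrite (size_crd_norm_x erefl b0); lia.
Qed.

Lemma size_crd_norm1 u : size (crd_norm u) = 1%N -> exists2 c, c != 0 & u = (c%:P, 0).
Proof.
case En: (size u.2) => [|n]; last by rewrite (size_crd_norm erefl En); lia.
have b0 : u.2 = 0 by apply/eqP; rewrite -size_poly_eq0 En.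
rewrite (size_crd_norm_x erefl b0) => s1.
have /eqP/size_poly1P [c c0 Ec] : size u.1 = 1%N by lia.
by exists c => //; rewrite [u]surjective_pairing b0 Ec.
Qed.

Lemma crd_dom : zero_free (R : comNzRingType).
Proof.
by move=> a b Ha Hb; rewrite -crd_norm_eq0 crd_normM mulf_neq0 // crd_norm_eq0.
Qed.

Definition crd_c (c : K) : R := (c%:P, 0).
Definition crd_x : R := ('X, 0).
Definition crd_y : R := (0, 1).

Lemma crd_cD c d : crd_c (c + d) = crd_c c + crd_c d.
Proof. by congr (_, _); rewrite ?polyCD //= addr0. Qed.
Lemma crd_cN c : crd_c (- c) = - crd_c c.
Proof. by congr (_, _); rewrite ?polyCN //= oppr0. Qed.
Lemma crd_cM c d : crd_c (c * d) = crd_c c * crd_c d.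
Proof. by congr (_, _); rewrite /= ?polyCM; ring. Qed.

Lemma crd_c_is_zmod_morphism : zmod_morphism crd_c.
Proof. by move=> c d; rewrite crd_cD crd_cN. Qed.
Lemma crd_c_is_monoid_morphism : monoid_morphism crd_c.
Proof. by split=> // c d; rewrite crd_cM. Qed.
HB.instance Definition _ := GRing.isZmodMorphism.Build K R crd_c crd_c_is_zmod_morphism.
HB.instance Definition _ := GRing.isMonoidMorphism.Build K R crd_c crd_c_is_monoid_morphism.

Lemma crd_curve : crd_y ^+ 2 = crd_x ^+ 3 + crd_c a2 * crd_x ^+ 2 + crd_c a4 * crd_x + crd_c a6
   - (crd_c a1 * crd_x * crd_y + crd_c a3 * crd_y).
Proof.
by congr (_, _); rewrite /= /crd_f /crd_h -!mul_polyC; ring.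
Qed.

Definition crd_ev (x y : K) (u : R) : K := u.1.[x] + u.2.[x] * y.

Lemma crd_evD x y u v : crd_ev x y (u + v) = crd_ev x y u + crd_ev x y v.
Proof. by rewrite /crd_ev /= !hornerD; ring. Qed.

Lemma crd_evM x y u v : on_curve E (Some (x, y)) ->
  crd_ev x y (u * v) = crd_ev x y u * crd_ev x y v.
Proof.
case: u v => [a b] [c d] /eqP Hc; rewrite /crd_ev /= /crd_f /crd_h !(hornerD, hornerN, hornerM, hornerZ, hornerXn, hornerX, hornerC).
have -> : a6 = y ^+ 2 + a1 * x * y + a3 * y - (x ^+ 3 + a2 * x ^+ 2 + a4 * x).
  by rewrite Hc; ring.
by ring.
Qed.

Definition pt_ideal (P : pt K) : seq R :=
  if P is Some (x, y) then [:: crd_x - crd_c x; crd_y - crd_c y] else [:: 1].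

Lemma pt_ideal_ev x y u : on_curve E (Some (x, y)) ->
  idl (pt_ideal (Some (x, y))) u -> crd_ev x y u = 0.
Proof.
move=> Hc; move: u; apply: idl_stable.
- by rewrite /crd_ev /= !horner0; ring.
- by move=> u v Hu Hv; rewrite crd_evD Hu Hv addr0.
- by move=> u v Hv; rewrite crd_evM // Hv mulr0.
by move=> g; rewrite !inE => /orP[] /eqP ->; rewrite /crd_ev /= !hornerE; ring.
Qed.

(** The norm of a generator [h] divides [('X - x) ^ 2]. Degree 1 being impossible, either [h] is
    constant, though it vanishes at the point, or [X - x] generates the ideal, though it does not
    divide [Y - y]. *)
Lemma pt_ideal_principal P : on_curve E P ->
  same_class (pt_ideal P) [:: 1] -> P = None.
Proof.
case: P => // -[x y] Hc [f [g [f0 g0 [H1 H2]]]].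
have HI : forall z, idl (pmul [:: f] (pt_ideal (Some (x, y)))) z ->
   exists2 u, idl (pt_ideal (Some (x, y))) u & z = f * u.
  apply: pmul_sub.
  - by exists 0; [exact: idl0|rewrite mulr0].
  - by move=> a b [u Hu ->] [v Hv ->]; exists (u + v); [exact: idlD|rewrite mulrDr].
  - by move=> a b [u Hu ->]; exists (a * u); [exact: idlM|rewrite mulrCA].
  by move=> a b /idl1[c ->] Hb; exists (c * b); [exact: idlM|rewrite mulrAC mulrC mulrA].
have [h Hh Eg] : exists2 u, idl (pt_ideal (Some (x, y))) u & g = f * u.
  by apply: HI; apply: H2; rewrite -[X in idl _ X]mulr1; apply: idl_pmul; apply: idl_head.
have can (a b : R) : f * a = f * b -> a = b.
  move=> /eqP; rewrite -subr_eq0 -mulrBr => H; apply/eqP; rewrite -subr_eq0.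
  by apply: contraLR H; apply: crd_dom.
have gen u : idl (pt_ideal (Some (x, y))) u -> exists c, u = c * h.
  move=> Hu; have /H1 : idl (pmul [:: f] (pt_ideal (Some (x, y)))) (f * u).
    by apply: idl_pmul => //; apply: idl_head.
  move=> /(proj1 (pmul11 g 1)) /idl1 [c Ec]; exists c.
  by apply: can; rewrite Ec mulr1 Eg; ring.
have [c Ec] : exists c, crd_x - crd_c x = c * h by apply: gen; apply: idl_gen; rewrite mem_head.
have [d Ed] : exists c, crd_y - crd_c y = c * h.
  by apply: gen; apply: idl_gen; rewrite !inE eqxx orbT.
have Nx : crd_norm (crd_x - crd_c x) = ('X - x%:P) ^+ 2.
  by rewrite /crd_norm /= subr0 !mulr0 !expr0n !mul0r !subr0.
have s3 : size (crd_norm c * crd_norm h) = 3%N.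
  by rewrite -crd_normM -Ec Nx size_exp_XsubC.
have [Nc Nh] : crd_norm c != 0 /\ crd_norm h != 0.
  by apply/andP; rewrite -negb_or -mulf_eq0 -size_poly_eq0 s3.
rewrite sizeM // in s3; move: Nc Nh; rewrite -!sizeP => Nc Nh.
have := size_crd_norm_neq2 c; have := size_crd_norm_neq2 h => n2 m2.
have [|] : size (crd_norm h) = 1%N \/ size (crd_norm c) = 1%N by lia.
  move=> /size_crd_norm1 [k k0 Eh]; have := pt_ideal_ev Hc Hh.
  by rewrite Eh /crd_ev /= hornerC horner0 mul0r addr0 => /eqP; rewrite (negPf k0).
move=> /size_crd_norm1 [k k0 Eck].
have E0 : crd_c k * (crd_y - crd_c y) = d * (crd_x - crd_c x).
  rewrite Ec Ed; have -> : c = crd_c k by [].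
  by ring.
(* The coefficients of [Y] show the nonzero constant [k] to be a multiple of ['X - x]; evaluation at
   [x] refutes this. *)
have E1 := congr1 snd E0.
have := congr1 (fun p : {poly K} => p.[x]) E1.
rewrite /= !(hornerD, hornerN, hornerM, hornerX, hornerC) => /eqP; rewrite ?mulr0 ?mul0r ?subr0 ?subrr ?mulr1 ?addr0 ?mulr0.
by rewrite mul0r subr0 addr0 (negPf k0).
Qed.

End CoordinateRing.

(** * Lines and the group law *)

(** All eight products of generators are divisible by [l]. The cofactors are [l'], [l ^ 2], the
    [u_i * u_j] and the [l * u_i]; the second hypothesis says that they generate the unit ideal. *)
Lemma line_idl (R : comNzRingType) (u1 u2 u3 l l' : R) :
  u1 * u2 * u3 = l * l' ->
  (forall Q : R -> Prop, Q 0 -> (forall a b, Q a -> Q b -> Q (a + b)) ->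
     (forall a b, Q b -> Q (a * b)) -> Q l' -> Q (l * l) -> Q (u1 * u2) -> Q (u1 * u3) ->
     Q (u2 * u3) -> Q (l * u1) -> Q (l * u2) -> Q (l * u3) -> Q 1) ->
  eqv (pmul (pmul [:: u1; l] [:: u2; l]) [:: u3; l]) [:: l].
Proof.
move=> Hu HQ; split.
  apply: sub_idlP => g; rewrite /pmul /= !inE => Hg; apply/idl1.
  case/orP: Hg => [/eqP ->|Hg]; first by exists l'; rewrite Hu mulrC.
  move: Hg; do ![case/orP] => /eqP ->.
  - by exists (u1 * u2).
  - by exists (u1 * u3); rewrite mulrAC.
  - by exists (u1 * l).
  - by exists (u2 * u3); ring.
  - by exists (l * u2); ring.
  - by exists (l * u3); ring.
  by exists (l * l); ring.
move=> z /idl1 [k ->]; apply: idlM.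
set P := pmul _ _.
have H a b c : a \in [:: u1; l] -> b \in [:: u2; l] -> c \in [:: u3; l] ->
    idl P (a * b * c).
  by move=> Ha Hb Hc; do !apply: idl_pmul; apply: idl_gen.
have [il m1 m2 m3] : [/\ l \in [:: u1; l], u1 \in [:: u1; l], u2 \in [:: u2; l] & u3 \in [:: u3; l]].
  by rewrite !inE !eqxx !orbT.
have il2 : l \in [:: u2; l] by rewrite !inE eqxx orbT.
have il3 : l \in [:: u3; l] by rewrite !inE eqxx orbT.
rewrite -[l]mulr1; apply: (HQ (fun j => idl P (l * j))).
- by rewrite mulr0; apply: idl0.
- by move=> a b; rewrite mulrDr; apply: idlD.
- by move=> a b; rewrite mulrCA; apply: idlM.
- by rewrite -Hu; apply: H.
- by rewrite mulrA; apply: H.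
- have -> : l * (u1 * u2) = u1 * u2 * l by ring.
  exact: H.
- have -> : l * (u1 * u3) = u1 * l * u3 by ring.
  exact: H.
- by rewrite mulrA; apply: H.
- have -> : l * (l * u1) = u1 * l * l by ring.
  exact: H.
- have -> : l * (l * u2) = l * u2 * l by ring.
  exact: H.
by rewrite mulrA; apply: H.
Qed.

Section GroupLaw.
Variables (K : fieldType) (E : wcurve K).
Local Notation a1 := (wa1 E). Local Notation a2 := (wa2 E).
Local Notation a3 := (wa3 E). Local Notation a4 := (wa4 E).
Local Notation a6 := (wa6 E).
Local Notation R := (crd E : comNzRingType).
Local Notation "\k c" := (crd_c E c) (at level 2, format "\k c").
Local Notation X := (crd_x E).
Local Notation Y := (crd_y E).

Definition psi2 (x y : K) : K := 2%:R * y + a1 * x + a3.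

(** Both partial derivatives vanish, so the point is singular. Solving for [a3], [a4] and [a6] makes
    the discriminant vanish identically. *)
Lemma singular_disc0 x y : on_curve E (Some (x, y)) -> psi2 x y = 0 ->
  3%:R * x ^+ 2 + 2%:R * a2 * x + a4 - a1 * y = 0 -> wdisc E = 0.
Proof.
rewrite /psi2 /wdisc /wb2 /wb4 /wb6 /wb8 /= => /eqP Hc H2 Hx.
have E3 : a3 = - (2%:R * y + a1 * x) by rewrite -[RHS]add0r -H2; ring.
have E4 : a4 = a1 * y - 3%:R * x ^+ 2 - 2%:R * a2 * x by rewrite -[RHS]add0r -Hx; ring.
have E6 : a6 = y ^+ 2 + a1 * x * y + a3 * y - (x ^+ 3 + a2 * x ^+ 2 + a4 * x).
  by rewrite Hc; ring.
by rewrite E6 E4 E3; ring.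
Qed.

Hypothesis hE : is_elliptic E.

Definition opppt (P : pt K) : pt K :=
  if P is Some (x, y) then Some (x, - y - a1 * x - a3) else None.

Lemma on_curve_opp P : on_curve E P -> on_curve E (opppt P).
Proof.
case: P => // -[x y] /eqP H; apply/eqP; rewrite -H; ring.
Qed.

Lemma opppt_inj P Q : opppt P = opppt Q -> P = Q.
Proof.
case: P Q => [[x y]|] [[x' y']|] //= [-> /addIr/addIr/oppr_inj ->] //.
Qed.

(** The product is the ideal of the vertical line [u = X - x]. All generators are multiples of [u];
    conversely, smoothness recovers [u] through whichever partial derivative is nonzero at the
    point. *)
Lemma opp_class P : on_curve E P ->
  same_class (pmul (pt_ideal E P) (pt_ideal E (opppt P))) [:: 1].
Proof.
case: P => [[x y]|] Hc; last by apply: eqv_class; exact: pmul1.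
have u0 : X - \k x != 0.
  by rewrite -crd_norm_eq0 /crd_norm /= subr0 !mulr0 !expr0n !mul0r !subr0 expf_neq0 // polyXsubC_eq0.
apply: class_trans (principal_class u0); first exact: crd_dom.
apply: eqv_class; rewrite /opppt /pt_ideal.
set u := X - \k x; set v := Y - \k y; set v' := Y - \k _.
(* The cofactor of [u] in [v * v']; its value at the point is, up to sign, the partial derivative in
   [x]. *)
pose w := X ^+ 2 + \k x * X + \k x ^+ 2 + \k a2 * (X + \k x) + \k a4 - \k a1 * Y.
have Hv : v * v' = u * w.
  have E6 : \k a6 = \k (y ^+ 2 + a1 * x * y + a3 * y - (x ^+ 3 + a2 * x ^+ 2 + a4 * x)).
    by congr crd_c; rewrite (eqP Hc); ring.
  rewrite /v' /v /u /w; have -> : (Y - \k y) * (Y - \k (- y - a1 * x - a3)) =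
     Y ^+ 2 + Y * (\k a1 * \k x + \k a3) + \k y * \k (- y - a1 * x - a3).
     by rewrite !rmorphB !rmorphN !rmorphM; ring.
  rewrite crd_curve E6 !(rmorphB, rmorphN, rmorphD, rmorphM, rmorphXn) /=; ring.
split.
  apply: sub_idlP => g; rewrite /pmul /= !inE => Hg; apply/idl1.
  move: Hg; do ![case/orP] => /eqP ->.
  - by exists u.
  - by exists v'; rewrite mulrC.
  - by exists v.
  by exists w; rewrite Hv mulrC.
move=> z /idl1 [k ->]; apply: idlM.
set P := pmul _ _.
have H a b : a \in [:: u; v] -> b \in [:: u; v'] -> idl P (a * b).
  by move=> Ha Hb; apply: idl_pmul; apply: idl_gen.
have [p2|p2] := eqVneq (psi2 x y) 0.
  have Hs : 3%:R * x ^+ 2 + 2%:R * a2 * x + a4 - a1 * y != 0.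
    by apply/eqP => /(singular_disc0 Hc p2) /eqP; apply/negP.
  move: Hs; set s := (X in X != 0) => s0.
  have -> : u = \k s^-1 * (v * v' - (u * u * (X + \k x + \k x + \k a2) - \k a1 * (v * u))).
    rewrite Hv.
    have -> : u * w - (u * u * (X + \k x + \k x + \k a2) - \k a1 * (v * u)) = u * \k s.
      rewrite /s !(rmorphB, rmorphN, rmorphD, rmorphM, rmorphXn) /= /w /u /v.
      by rewrite ?rmorph_nat; ring.
    by rewrite mulrCA -rmorphM mulVf // rmorph1 mulr1.
  apply: idlM; apply: idlB; first by apply: H; rewrite !inE eqxx ?orbT.
  apply: idlB; first by rewrite mulrC; apply: idlM; apply: H; rewrite !inE eqxx.
  by apply: idlM; apply: H; rewrite !inE eqxx ?orbT.
have -> : u = \k (psi2 x y)^-1 * (u * v' - v * u).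
  have -> : u * v' - v * u = u * \k (psi2 x y).
    rewrite /psi2 /v' /v /u !(rmorphB, rmorphN, rmorphD, rmorphM, rmorphXn) /=.
    by rewrite ?rmorph_nat; ring.
  by rewrite mulrCA -rmorphM mulVf // rmorph1 mulr1.
by apply: idlM; apply: idlB; apply: H; rewrite !inE eqxx ?orbT.
Qed.

(* The line y = lam x + nu meets the curve at x1, x2, x3, with multiplicity. *)
Definition chord (lam nu x1 x2 x3 : K) :=
  [/\ a2 = lam ^+ 2 + a1 * lam - (x1 + x2 + x3),
      a4 = 2%:R * lam * nu + a1 * nu + a3 * lam + (x1 * x2 + x1 * x3 + x2 * x3) &
      a6 = nu ^+ 2 + a3 * nu - x1 * x2 * x3].

Lemma chord12 lam nu x1 x2 x3 : chord lam nu x1 x2 x3 -> chord lam nu x2 x1 x3.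
Proof. by case=> H2 H4 H6; split; rewrite ?H2 ?H4 ?H6; ring. Qed.

Lemma chord23 lam nu x1 x2 x3 : chord lam nu x1 x2 x3 -> chord lam nu x1 x3 x2.
Proof. by case=> H2 H4 H6; split; rewrite ?H2 ?H4 ?H6; ring. Qed.

Lemma chord_on_curve lam nu x1 x2 x3 : chord lam nu x1 x2 x3 ->
  on_curve E (Some (x1, lam * x1 + nu)).
Proof. by case=> H2 H4 H6; apply/eqP; rewrite H2 H4 H6; ring. Qed.

(** If [x1] is a double intersection, [lam] is the slope of the tangent, so [lam * psi2] is the
    derivative in [x]; if [psi2] vanished too, the point would be singular. *)
Lemma chord_psi2 lam nu x1 x2 x3 : chord lam nu x1 x2 x3 -> x1 = x2 ->
  psi2 x1 (lam * x1 + nu) != 0.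
Proof.
move=> Hc E12; apply/eqP => H; have /eqP := hE; apply.
apply: (singular_disc0 (chord_on_curve Hc) H).
case: Hc => H2 H4 H6; rewrite -[RHS](mulr0 lam) -H /psi2 H2 H4 -E12.
by ring.
Qed.

Lemma pt_ideal_line lam nu x :
  eqv (pt_ideal E (Some (x, lam * x + nu)))
      [:: X - \k x; Y - \k lam * X - \k nu].
Proof.
rewrite /pt_ideal; set u := X - _; set v := Y - _; set l := Y - _ - _.
have Ev : v = l + \k lam * u by rewrite /v /l /u rmorphD rmorphM /=; ring.
split; apply: sub_idlP => g; rewrite !inE => /orP[] /eqP ->.
- by apply: idl_gen; rewrite !inE eqxx.
- by rewrite Ev; apply: idlD; [|apply: idlM]; apply: idl_gen; rewrite !inE eqxx ?orbT.
- by apply: idl_gen; rewrite !inE eqxx.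
have -> : l = v - \k lam * u by rewrite Ev; ring.
by apply: idlB; [|apply: idlM]; apply: idl_gen; rewrite !inE eqxx ?orbT.
Qed.

(** The product of the three ideals is generated by the equation [l] of the line. The cofactors
    generate 1: when two abscissae agree, by tangency and [psi2 != 0]; when all differ, by
    differences of the products [u_i * u_j]. *)
Lemma chord_class lam nu x1 x2 x3 : chord lam nu x1 x2 x3 ->
  same_class (pmul (pmul (pt_ideal E (Some (x1, lam * x1 + nu)))
                         (pt_ideal E (Some (x2, lam * x2 + nu))))
                   (pt_ideal E (Some (x3, lam * x3 + nu)))) [:: 1].
Proof.
move=> Hc; pose l := Y - \k lam * X - \k nu.
have l0 : l != 0.
  apply/eqP => /(congr1 snd) /=; rewrite /= !mulr0 !mul0r !subr0 ?addr0 ?mul0r ?subr0.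
  by move/eqP; rewrite oner_eq0.
apply: class_trans (principal_class l0); first exact: crd_dom.
apply: eqv_class; apply: eqv_trans.
  by apply: eqv_pmul; [apply: eqv_pmul|]; apply: pt_ideal_line.
rewrite -/l.
(* Minus the conjugate of [l], so that [l * l'] is the monic cubic in [X] with roots [x1], [x2],
   [x3]. *)
pose l' := Y + \k a1 * X + \k a3 + \k lam * X + \k nu.
apply: (@line_idl _ _ _ _ _ l').
  case: Hc => H2 H4 H6.
  have -> : l * l' = Y ^+ 2 + Y * (\k a1 * X + \k a3) - (\k lam * X + \k nu) * (\k lam * X + \k nu + \k a1 * X + \k a3).
    by rewrite /l /l'; ring.
  rewrite crd_curve H2 H4 H6 !(rmorphB, rmorphN, rmorphD, rmorphM, rmorphXn) /=.
  by rewrite ?rmorph_nat; ring.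
move=> Q Q0 QD QM Ql' Qll Q12 Q13 Q23 Ql1 Ql2 Ql3.
have QZ c z : c != 0 -> Q (\k c * z) -> Q z.
  move=> c0 H; have -> : z = \k c^-1 * (\k c * z) by rewrite mulrA -rmorphM mulVf // rmorph1 mul1r.
  exact: (QM _ _).
(* [E1] reads [psi2 = l' - l - (a1 + 2 lam) (X - x)]. Multiplied by [X - x], by [l] and by 1, it
   puts these three in [Q] in turn. *)
have main x : psi2 x (lam * x + nu) != 0 -> Q (l * (X - \k x)) -> 
   Q ((X - \k x) * (X - \k x)) -> Q 1.
  move=> p0 Qlu Quu.
  have E1 u : \k (psi2 x (lam * x + nu)) * u = l' * u - l * u - (\k a1 + 2%:R * \k lam) * ((X - \k x) * u).
    rewrite /psi2 /l /l' !(rmorphB, rmorphN, rmorphD, rmorphM, rmorphXn) /=.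
    by rewrite ?rmorph_nat; ring.
  have QB a b : Q a -> Q b -> Q (a - b).
    by move=> Qa Qb; apply QD => //; rewrite -mulN1r; apply QM.
  have Qu : Q (X - \k x).
    apply: (QZ _ _ p0); rewrite E1; apply QB; [apply QB|exact: (QM _ _)] => //.
    by rewrite mulrC; apply QM.
  have Ql : Q l.
    apply: (QZ _ _ p0); rewrite E1; apply QB; first apply QB.
    - by rewrite mulrC; apply QM.
    - by [].
    by apply QM; rewrite mulrC; apply QM.
  apply: (QZ _ _ p0); rewrite E1; apply QB; first apply QB.
  - by rewrite mulr1.
  - by rewrite mulr1.
  by apply QM; rewrite mulr1.
have [e12|n12] := eqVneq x1 x2.
  by apply: (main x1 (chord_psi2 Hc e12)) => //; rewrite {2}e12.
have [e13|n13] := eqVneq x1 x3.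
  by apply: (main x1 (chord_psi2 (chord23 Hc) e13)) => //; rewrite {2}e13.
have [e23|n23] := eqVneq x2 x3.
  by apply: (main x2 (chord_psi2 (chord23 (chord12 Hc)) e23)) => //; rewrite {2}e23.
have QB a b : Q a -> Q b -> Q (a - b).
  by move=> Qa Qb; apply QD => //; rewrite -mulN1r; apply QM.
have Q3 : Q (X - \k x3).
  apply: (QZ (x2 - x1)); first by rewrite subr_eq0 eq_sym.
  have -> : \k (x2 - x1) * (X - \k x3) = (X - \k x1) * (X - \k x3) - (X - \k x2) * (X - \k x3).
    by rewrite rmorphB /=; ring.
  exact: (QB _ _).
have Q2 : Q (X - \k x2).
  apply: (QZ (x3 - x1)); first by rewrite subr_eq0 eq_sym.
  have -> : \k (x3 - x1) * (X - \k x2) = (X - \k x1) * (X - \k x2) - (X - \k x2) * (X - \k x3).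
    by rewrite rmorphB /=; ring.
  exact: (QB _ _).
apply: (QZ (x3 - x2)); first by rewrite subr_eq0 eq_sym.
have -> : \k (x3 - x2) * 1 = (X - \k x2) - (X - \k x3) by rewrite rmorphB /=; ring.
exact: (QB _ _).
Qed.

Lemma addpt_chord x1 y1 x2 y2 :
  on_curve E (Some (x1, y1)) -> on_curve E (Some (x2, y2)) ->
  ~~ ((x1 == x2) && (y1 + y2 + a1 * x2 + a3 == 0)) ->
  exists lam nu x3, [/\ y1 = lam * x1 + nu, y2 = lam * x2 + nu,
    chord lam nu x1 x2 x3 &
    addpt E (Some (x1, y1)) (Some (x2, y2)) = opppt (Some (x3, lam * x3 + nu))].
Proof.
move=> /eqP H1 /eqP H2 nd; rewrite /addpt (negPf nd) /=.
have E6 : a6 = y1 ^+ 2 + a1 * x1 * y1 + a3 * y1 - (x1 ^+ 3 + a2 * x1 ^+ 2 + a4 * x1).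
  by rewrite H1; ring.
have [e12|n12] := eqVneq x1 x2; rewrite /=.
  move: nd H2; rewrite -e12 eqxx /= => nd H2.
  have ey : y1 = y2.
    have : (y1 - y2) * (y1 + y2 + a1 * x1 + a3) = 0.
      have -> : (y1 - y2) * (y1 + y2 + a1 * x1 + a3) = (y1 ^+ 2 + a1 * x1 * y1 + a3 * y1) - (y2 ^+ 2 + a1 * x1 * y2 + a3 * y2) by ring.
      by rewrite H1 H2 subrr.
    by move/eqP; rewrite mulf_eq0 (negPf nd) orbF subr_eq0 => /eqP.
  move: nd; rewrite -{}ey => nd.
  have nd' : 2%:R * y1 + a1 * x1 + a3 != 0 by move: nd; congr (_ != 0); ring.
  set lam := _ / _; set nu := _ / _; set x3 := _ - _.
  have El : y1 = lam * x1 + nu.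
    by rewrite /lam /nu E6; field.
  exists lam, nu, x3; split=> //.
    split.
    - by rewrite /x3; ring.
    - rewrite /x3 /lam /nu E6; field => //.
    - rewrite /x3 /lam /nu E6; field => //.
  by congr (Some (_, _)); ring.
set lam := _ / _; set nu := _ / _; set x3 := _ - _.
have n12' : x2 - x1 != 0 by rewrite subr_eq0 eq_sym.
(* For distinct abscissae the two curve equations determine [a4] and [a6]; after this substitution
   the chord relations are rational identities. *)
have E4 : a4 = ((y2 ^+ 2 + a1 * x2 * y2 + a3 * y2 - x2 ^+ 3 - a2 * x2 ^+ 2) - (y1 ^+ 2 + a1 * x1 * y1 + a3 * y1 - x1 ^+ 3 - a2 * x1 ^+ 2)) / (x2 - x1).
  by rewrite H1 H2; field.
exists lam, nu, x3; split=> //.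
- by rewrite /lam /nu; field.
- by rewrite /lam /nu; field.
- split.
  + by rewrite /x3; ring.
  + rewrite /x3 /lam /nu E4; field => //.
  + rewrite /x3 /lam /nu E6 E4; field => //.
by congr (Some (_, _)); ring.
Qed.

End GroupLaw.

Section GroupLaw2.
Variables (K : fieldType) (E : wcurve K) (hE : is_elliptic E).
Local Notation a1 := (wa1 E). Local Notation a3 := (wa3 E).

Lemma opppt_cond x1 y1 x2 y2 :
  ((x1 == x2) && (y1 + y2 + a1 * x2 + a3 == 0)) =
  (Some (x2, y2) == opppt E (Some (x1, y1))).
Proof.
rewrite -[RHS]/((x2 == x1) && (y2 == _)) [x2 == x1]eq_sym; case: eqVneq => //= ->.
by rewrite -[RHS]subr_eq0; congr (_ == 0); ring.
Qed.

Lemma addpt_chordP P Q : on_curve E P -> on_curve E Q -> P != None -> Q != None ->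
  Q != opppt E P ->
  exists lam nu x1 x2 x3, [/\ P = Some (x1, lam * x1 + nu), Q = Some (x2, lam * x2 + nu),
    chord E lam nu x1 x2 x3 & addpt E P Q = opppt E (Some (x3, lam * x3 + nu))].
Proof.
case: P Q => [[x1 y1]|] // [[x2 y2]|] // H1 H2 _ _.
rewrite -opppt_cond => /(addpt_chord H1 H2) [lam [nu [x3 [E1 E2 Hc Ha]]]].
by exists lam, nu, x1, x2, x3; rewrite -E1 -E2.
Qed.

Lemma addpt_opp P Q : Q == opppt E P -> addpt E P Q = None.
Proof.
case: P Q => [[x1 y1]|] [[x2 y2]|] // H.
by rewrite /addpt opppt_cond H.
Qed.

Lemma addpt0 P : addpt E P None = P. Proof. by case: P => [[]|]. Qed.

Lemma on_curve_add P Q : on_curve E P -> on_curve E Q -> on_curve E (addpt E P Q).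
Proof.
move=> HP HQ; case P0: (P == None); first by rewrite (eqP P0).
case Q0: (Q == None); first by rewrite (eqP Q0) addpt0.
have [/eqP/addpt_opp ->//|n] := eqVneq Q (opppt E P).
have [lam [nu [x1 [x2 [x3 [_ _ Hc ->]]]]]] := addpt_chordP HP HQ (negbT P0) (negbT Q0) n.
by apply/on_curve_opp/(chord_on_curve (chord12 (chord23 Hc))).
Qed.

Local Notation dom := (@crd_dom K E).
Local Notation I := (pt_ideal E).

(** The third point [T] of the chord satisfies [I P * I Q * I T ~ 1] and [P + Q = - T]; multiply by
    the class of [- T]. *)
Lemma add_class P Q : on_curve E P -> on_curve E Q ->
  same_class (pmul (I P) (I Q)) (I (addpt E P Q)).
Proof.
move=> HP HQ; case P0: (P == None).
  by rewrite (eqP P0); apply: eqv_class; apply: pmul1.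
case Q0: (Q == None).
  rewrite (eqP Q0) addpt0; apply: eqv_class; apply: eqv_trans (pmulC _ _) _; exact: pmul1.
have [EQ|n] := eqVneq Q (opppt E P).
  by rewrite addpt_opp ?EQ //; apply: opp_class.
have [lam [nu [x1 [x2 [x3 [-> -> Hc ->]]]]]] := addpt_chordP HP HQ (negbT P0) (negbT Q0) n.
have HT := chord_on_curve (chord12 (chord23 Hc)).
have H1 := chord_class hE Hc; set T := Some (x3, _) in HT H1 *.
set J := pmul (I (Some (x1, _))) (I _) in H1 *.
have H2 : same_class J (pmul (pmul J (I T)) (I (opppt E T))).
  apply: (class_trans dom) (class_sym (eqv_class (pmulA _ _ _))).
  apply: (class_trans dom) (class_pmulr dom J (class_sym (opp_class hE HT))).
  by apply: eqv_class; apply: eqv_trans (eqv_sym (pmul1 _)) (pmulC _ _).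
apply: (class_trans dom H2); apply: (class_trans dom) (class_pmul _ H1) _.
exact: eqv_class (pmul1 _).
Qed.

Lemma pt_ideal_inj P Q : on_curve E P -> on_curve E Q -> same_class (I P) (I Q) -> P = Q.
Proof.
move=> HP HQ H.
have HQ' := on_curve_opp HQ.
have : addpt E P (opppt E Q) = None.
  apply: (pt_ideal_principal (on_curve_add HP HQ')).
  apply: (class_trans dom) (opp_class hE HQ).
  apply: (class_trans dom) (class_pmul _ H).
  by apply: class_sym; apply: add_class.
move=> H0; apply/esym; apply: (@opppt_inj _ E); apply/eqP; apply: contra_eqT H0 => n.
case P0: (P == None).
  by move: n; rewrite (eqP P0); case: (Q) => [[x y]|].
case Q0: (opppt E Q == None).
  by rewrite (eqP Q0) addpt0 P0.
by have [lam [nu [x1 [x2 [x3 [-> -> Hc ->]]]]]] := addpt_chordP HP HQ' (negbT P0) (negbT Q0) n.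
Qed.

Lemma addptC P Q : on_curve E P -> on_curve E Q -> addpt E P Q = addpt E Q P.
Proof.
move=> HP HQ; apply: pt_ideal_inj; try exact: on_curve_add.
apply: (class_trans dom) (add_class HQ HP).
apply: (class_trans dom) (eqv_class (pmulC _ _)).
by apply: class_sym; apply: add_class.
Qed.

Lemma addptA P Q S : on_curve E P -> on_curve E Q -> on_curve E S ->
  addpt E P (addpt E Q S) = addpt E (addpt E P Q) S.
Proof.
move=> HP HQ HS; apply: pt_ideal_inj; try by do !apply: on_curve_add.
have HPQ := on_curve_add HP HQ; have HQS := on_curve_add HQ HS.
apply: (class_trans dom) (add_class HPQ HS).
apply: (class_trans dom) (class_pmul _ (add_class HP HQ)).
apply: (class_trans dom) (class_sym (eqv_class (pmulA _ _ _))).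
apply: (class_trans dom) (class_sym (class_pmulr dom _ (add_class HQ HS))).
by apply: class_sym; apply: add_class.
Qed.
End GroupLaw2.

(** The type carries [hE], so that the group structure, which depends on it, can be inferred. *)
Definition epoint (K : fieldType) (E : wcurve K) (hE : is_elliptic E) : Type :=
  {P : option (K * K) | on_curve E P}.

Section PointGroup.
Variables (K : fieldType) (E : wcurve K) (hE : is_elliptic E).
Local Notation U := (epoint hE).
HB.instance Definition _ := SubChoice.copy U {P : option (K * K) | on_curve E P}.

Definition epoint_zero : U := exist (fun P => on_curve E P) None isT.
Definition epoint_opp (P : U) : U := exist (fun P => on_curve E P) _ (on_curve_opp (valP P)).
Definition epoint_add (P Q : U) : U :=
  exist (fun P => on_curve E P) _ (on_curve_add (valP P) (valP Q)).

Lemma epoint_addA : associative epoint_add.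
Proof. by move=> P Q S; apply: val_inj; apply: addptA => //; apply: valP. Qed.
Lemma epoint_addC : commutative epoint_add.
Proof. by move=> P Q; apply: val_inj; apply: addptC => //; apply: valP. Qed.
Lemma epoint_add0 : left_id epoint_zero epoint_add.
Proof. by move=> P; apply: val_inj. Qed.
Lemma epoint_addN : left_inverse epoint_zero epoint_opp epoint_add.
Proof.
move=> P; apply: val_inj; rewrite -[RHS]/(None : pt K).
have := epoint_addC (epoint_opp P) P => /(congr1 val) /= ->.
exact: addpt_opp.
Qed.
HB.instance Definition _ := GRing.isZmodule.Build U
  epoint_addA epoint_addC epoint_add0 epoint_addN.

Lemma val_epointD (P Q : U) : val (P + Q) = addpt E (val P) (val Q).
Proof. by []. Qed.
Lemma val_epointN (P : U) : val (- P) = opppt E (val P).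
Proof. by []. Qed.
Lemma val_epointMn (P : U) n : val (P *+ n) = mulpt E n (val P).
Proof. by elim: n => // n IH; rewrite mulrS val_epointD IH. Qed.
End PointGroup.

(** * Somos-4 sequences *)

(* Here [p], [q], [r], [s] are f (m - 1), ..., f (m + 2), and [k3], [k2], [t] are
   f (m - 3), f (m - 2), f (m + 3): the Somos-4 relation at 2 m. *)
Lemma dbl_even (F : fieldType) (k3 k2 p q r s t al be b : F) :
  p != 0 -> r != 0 -> s != 0 ->
  s * k2 = al * r * p - b * q ^+ 2 ->
  t * p = be * s * q - b * r ^+ 2 ->
  r * k3 = be * q * k2 - b * p ^+ 2 ->
  r * (t * q ^+ 2 - p * s ^+ 2) * (p * (r * k2 ^+ 2 - k3 * q ^+ 2)) =
  (be * s * q ^+ 3 - al * p * r ^+ 3) * (al * r * p ^+ 3 - be * k2 * q ^+ 3)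
  - b * (q * (s * p ^+ 2 - k2 * r ^+ 2)) ^+ 2.
Proof.
move=> p0 r0 s0 H2 Ht H3.
have E2 : k2 = (al * r * p - b * q ^+ 2) / s by rewrite -H2; field.
have Et : t = (be * s * q - b * r ^+ 2) / p by rewrite -Ht; field.
have E3 : k3 = (be * q * k2 - b * p ^+ 2) / r by rewrite -H3; field.
rewrite Et E3 E2; field; rewrite ?p0 ?r0 ?s0 //.
Qed.

(** The relation at [2 m + 1], where the relations at [m] and [m + 1] suffice; they are solved for
    the outer terms. *)
Lemma dbl_odd (F : fieldType) (k2 p q r s t al be b : F) :
  p != 0 -> s != 0 ->
  s * k2 = al * r * p - b * q ^+ 2 ->
  t * p = be * s * q - b * r ^+ 2 ->
  (al * t * r ^+ 3 - be * q * s ^+ 3) * (al * r * p ^+ 3 - be * k2 * q ^+ 3) =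
  al * be * (r * (t * q ^+ 2 - p * s ^+ 2)) * (q * (s * p ^+ 2 - k2 * r ^+ 2))
  - b * (be * s * q ^+ 3 - al * p * r ^+ 3) ^+ 2.
Proof.
move=> p0 s0 H2 Ht.
have E2 : k2 = (al * r * p - b * q ^+ 2) / s by rewrite -H2; field.
have Et : t = (be * s * q - b * r ^+ 2) / p by rewrite -Ht; field.
rewrite Et E2; field; rewrite ?p0 ?s0 //.
Qed.

Section Somos.
Variables (F : fieldType) (f : nat -> F) (A b c : F).
(** As [psi_n = psi_2 * f n] for even [n], the powers of [psi_2] in the Somos relation cancel for
    even [n] and leave [A = psi_2 ^ 4] for odd [n]. *)
Definition alph n : F := if odd n then A else 1.
Hypothesis f0 : f 0 = 0.
Hypothesis f1 : f 1 = 1.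
Hypothesis f2 : f 2 = 1.
Hypothesis f3 : f 3 = b.
Hypothesis f4 : f 4 + A = c * b.
Hypothesis fodd : forall m, (2 <= m)%N ->
  f (m.*2.+1) = alph m.+1 * f m.+2 * f m ^+ 3 - alph m * f m.-1 * f m.+1 ^+ 3.
Hypothesis feven : forall m, (3 <= m)%N ->
  f (m.*2) = f m * (f m.+2 * f m.-1 ^+ 2 - f m.-2 * f m.+1 ^+ 2).

Definition somos4 n := f n.+2 * f n.-2 = alph n * f n.+1 * f n.-1 - b * f n ^+ 2.
(** A first integral of the recurrence: the left side divided by [f n.-1 * f n * f n.+1] is the same
    [c] for all [n]. *)
Definition somosJ n := f n.+2 * f n.-1 ^+ 2 + f n.-2 * f n.+1 ^+ 2 + alph n.+1 * f n ^+ 3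
   = c * f n.-1 * f n * f n.+1.
Definition nonzero_below n := forall k, (0 < k < n)%N -> f k != 0.

Lemma alph2 n : alph n.+2 = alph n. Proof. by rewrite /alph /= negbK. Qed.
Lemma alph_even n : alph n.*2 = 1. Proof. by rewrite /alph odd_double. Qed.
Lemma alph_odd n : alph n.*2.+1 = alph n * alph n.+1.
Proof. by rewrite /alph /= odd_double /=; case: odd; rewrite ?mulr1 ?mul1r. Qed.

Lemma alphm n : (0 < n)%N -> alph n.-1 = alph n.+1.
Proof. by case: n => // n _; rewrite alph2. Qed.

Lemma fodd1 m : (1 <= m)%N ->
  f (m.*2.+1) = alph m.+1 * f m.+2 * f m ^+ 3 - alph m * f m.-1 * f m.+1 ^+ 3.
Proof.
case: m => // -[_|m _]; last exact: fodd.
by rewrite /= /alph /= f0 f1 f2 f3; ring.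
Qed.

Lemma feven2 m : (2 <= m)%N ->
  f (m.*2) = f m * (f m.+2 * f m.-1 ^+ 2 - f m.-2 * f m.+1 ^+ 2).
Proof.
case: m => // -[|[_|m _]] //; last exact: feven.
by rewrite /= f0 f1 f2; ring.
Qed.

(** The doubling formulas reduce the relation at [2 m] or [2 m + 1] to those at [m - 1], [m] and
    [m + 1], which lie below [n] from 5 on. The nonvanishing assumption pays for the divisions. *)
Lemma somos4_all n : (2 <= n)%N -> nonzero_below n -> somos4 n.
Proof.
elim/ltn_ind: n => n IH n2 nz.
have [n4|n5] := leqP n 4.
  have [E|[E|E]] : n = 2%N \/ n = 3%N \/ n = 4%N by lia.
  - by rewrite E /somos4 /= /alph /= f0 f1 f2 f3; ring.
  - rewrite E /somos4 /= (fodd (m := 2)) // /alph /= f1 f2 f3; ring.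
  rewrite E /somos4 /= (feven (m := 3)) // /alph /= f1 f2 f3; ring.
have nzb k : (k < n)%N -> (2 <= k)%N -> somos4 k.
  by move=> kn k2; apply: IH => // j jk; apply: nz; lia.
pose m := n./2.
have [E|E] : n = m.*2.+1 \/ n = m.*2 by have := odd_double_half n; rewrite -/m; case: odd; lia.
  have m2 : (2 <= m)%N by lia.
  have e3 : f m.*2.+3 = alph m * f m.+3 * f m.+1 ^+ 3 - alph m.+1 * f m * f m.+2 ^+ 3.
    by rewrite -[m.*2.+3]/(m.+1.*2.+1) fodd1 // alph2.
  have em : f m.*2.-1 = alph m * f m.+1 * f m.-1 ^+ 3 - alph m.+1 * f m.-2 * f m ^+ 3.
    have -> : m.*2.-1 = m.-1.*2.+1 by lia.
    by rewrite fodd1 ?alphm ?prednK //; lia.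
  rewrite E /somos4 -[m.*2.+1.+2]/(m.*2.+3) -[m.*2.+1.-2]/(m.*2.-1) e3 em.
  rewrite -[m.*2.+1.+1]/(m.+1.*2) -[m.*2.+1.-1]/(m.*2) fodd1 ?feven2 // ?alph_odd; try lia.
  have H := nzb m; have H' := nzb m.+1.
  apply: dbl_odd.
  - by apply: nz; lia.
  - by apply: nz; lia.
  - by apply: H; lia.
  by rewrite -[m.-1]/(m.+1.-2) H' ?alph2 //; lia.
have m3 : (3 <= m)%N by lia.
have em : f m.*2.-1 = alph m * f m.+1 * f m.-1 ^+ 3 - alph m.+1 * f m.-2 * f m ^+ 3.
  have -> : m.*2.-1 = m.-1.*2.+1 by lia.
  by rewrite fodd1 ?alphm ?prednK //; lia.
have e2 : f m.*2.-2 = f m.-1 * (f m.+1 * f m.-2 ^+ 2 - f m.-1.-2 * f m ^+ 2).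
  have -> : m.*2.-2 = m.-1.*2 by lia.
  by rewrite feven2 ?prednK //; lia.
rewrite E /somos4 -[m.*2.+2]/(m.+1.*2) e2 em fodd1 ?feven2 // ?alph_even; try lia.
rewrite mul1r; have H := nzb m; have H' := nzb m.+1; have H'' := nzb m.-1.
apply: dbl_even.
- by apply: nz; lia.
- by apply: nz; lia.
- by apply: nz; lia.
- by apply: H; lia.
- by rewrite -[m.-1]/(m.+1.-2) H' ?alph2 //; lia.
have := H''; rewrite /somos4 alphm ?prednK; try lia.
by apply; lia.
Qed.

(** Multiplied by [f n.-1], the identity at [n + 1] becomes that at [n] times [f n.+2], modulo the
    Somos relations at [n] and [n + 1]. *)
Lemma somosJ_all n : (2 <= n)%N -> nonzero_below n -> somosJ n.
Proof.
elim: n => // n IH n2 nz; have [E|n3] := eqVneq n 1%N.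
  by rewrite E /somosJ /= /alph /= f0 f1 f2 f3 -(addrK A (f 4)) f4; ring.
have n2' : (2 <= n)%N by lia.
have nz' : nonzero_below n by move=> k kn; apply: nz; lia.
have J := IH n2' nz'; have S1 := somos4_all n2' nz'; have S2 := somos4_all n2 nz.
move: J S1 S2; rewrite /somosJ /somos4 /= alph2 => J S1 S2.
have p0 : f n.-1 != 0 by apply: nz; lia.
apply: (mulIf p0).
transitivity ((c * f n.-1 * f n * f n.+1) * f n.+2); last by ring.
rewrite -J.
have -> : (f n.+3 * f n ^+ 2 + f n.-1 * f n.+2 ^+ 2 + alph n * f n.+1 ^+ 3) * f n.-1
  = (f n.+3 * f n.-1) * f n ^+ 2 + f n.-1 ^+ 2 * f n.+2 ^+ 2 + alph n * f n.+1 ^+ 3 * f n.-1 by ring.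
have -> : (f n.+2 * f n.-1 ^+ 2 + f n.-2 * f n.+1 ^+ 2 + alph n.+1 * f n ^+ 3) * f n.+2
  = (f n.+2 * f n.-2) * f n.+1 ^+ 2 + f n.-1 ^+ 2 * f n.+2 ^+ 2 + alph n.+1 * f n ^+ 3 * f n.+2 by ring.
by rewrite S1 S2; ring.
Qed.
End Somos.

(** * Division polynomials *)

Section DivisionPolynomials.
Variables (K : fieldType) (E : wcurve K).
Local Notation f := (dpf E).
Local Notation F := (dpF E).

Lemma dpf_fuelE fuel n : (n < fuel)%N -> dpf_fuel E fuel n = f n.
Proof.
suff H : forall a b n, (n < a)%N -> (n < b)%N -> dpf_fuel E a n = dpf_fuel E b n.
  by move=> lt; apply: H.
elim=> [|a IH] // [|b] // {}n na nb.
case: n na nb => [|[|[|[|[|n]]]]] // na nb; rewrite /=.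
case: ifP => _; [case: ifP => _|]; do ![congr (_ - _)|congr (_ * _)|congr (_ ^+ _)]; apply: IH; lia.
Qed.

Lemma dpf_fuelS a n : dpf_fuel E a.+1 n.+4.+1 =
  let g := dpf_fuel E a in let m := n.+4.+1./2 in
  if odd n.+4.+1 then
     if odd m then g (m + 2)%N * g m ^+ 3 - F ^+ 2 * g (m - 1)%N * g (m + 1)%N ^+ 3
     else F ^+ 2 * g (m + 2)%N * g m ^+ 3 - g (m - 1)%N * g (m + 1)%N ^+ 3
  else g m * (g (m + 2)%N * g (m - 1)%N ^+ 2 - g (m - 2)%N * g (m + 1)%N ^+ 2).
Proof. exact: erefl. Qed.

Lemma dpf_rec n m : (5 <= n)%N -> m = n./2 -> f n =
  if odd n then
    if odd m then f m.+2 * f m ^+ 3 - F ^+ 2 * f m.-1 * f m.+1 ^+ 3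
    else F ^+ 2 * f m.+2 * f m ^+ 3 - f m.-1 * f m.+1 ^+ 3
  else f m * (f m.+2 * f m.-1 ^+ 2 - f m.-2 * f m.+1 ^+ 2).
Proof.
case: n => [|[|[|[|[|n]]]]] // _ Em.
have km : (m.+2 < n.+4.+1)%N by rewrite Em; lia.
rewrite {1}/dpf dpf_fuelS -Em; move: (n.+4.+1) km => k km; rewrite /=.
by rewrite !dpf_fuelE ?addn2 ?addn1 ?subn1 ?subn2 //; lia.
Qed.

Arguments dpf : simpl never.

Lemma dpf_odd m : (2 <= m)%N -> f (m.*2.+1) =
  if odd m then f m.+2 * f m ^+ 3 - F ^+ 2 * f m.-1 * f m.+1 ^+ 3
  else F ^+ 2 * f m.+2 * f m ^+ 3 - f m.-1 * f m.+1 ^+ 3.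
Proof.
by move=> m2; rewrite (@dpf_rec _ m) /= ?odd_double ?uphalf_double //; lia.
Qed.

Lemma dpf_even m : (3 <= m)%N -> f (m.*2) =
  f m * (f m.+2 * f m.-1 ^+ 2 - f m.-2 * f m.+1 ^+ 2).
Proof.
by move=> m2; rewrite (@dpf_rec _ m) ?odd_double ?doubleK //; lia.
Qed.

Lemma dpf0 : f 0 = 0. Proof. by []. Qed.
Lemma dpf1 : f 1 = 1. Proof. by []. Qed.
Lemma dpf2 : f 2 = 1. Proof. by []. Qed.
Lemma dpf3E : f 3 = dpf3 E. Proof. by []. Qed.
Lemma dpf4E : f 4 = dpf4 E. Proof. by []. Qed.

(** Half the derivative of [dpF], written without division; it is the constant [c] of [somosJ]. *)
Definition dpc : {poly K} := 6%:R *: 'X ^+ 2 + wb2 E *: 'X + (wb4 E)%:P.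

Lemma dpf4_rel : f 4 + F ^+ 2 = dpc * f 3.
Proof.
rewrite dpf4E dpf3E /dpf4 /dpf3 /dpF /dpc /wb8 /wb2 /wb4 /wb6 -!mul_polyC; ring.
Qed.

(** The coefficient [a] may be zero: the leading coefficients below are integers that can vanish in
    [K], where an equation on sizes would fail. *)
Definition lead_at (p : {poly K}) d (a : K) := (size p <= d.+1)%N /\ p`_d = a.

Lemma lead_atM p q d e a b : lead_at p d a -> lead_at q e b ->
  lead_at (p * q) (d + e) (a * b).
Proof.
case=> sp pd [sq qe]; split.
  by apply: leq_trans (size_polyMleq _ _) _; rewrite -ltnS; move: sp sq; case: size => [|s]; lia.
rewrite coefM; have dlt : (d < (d + e).+1)%N by lia.
rewrite (bigD1 (Ordinal dlt)) //= addKn pd qe big1 ?addr0 // => i ni.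
have /eqP n : i != d :> nat by apply: contra ni => /eqP E'; apply/eqP/val_inj.
have [lt|ge] := ltnP i d.
  by rewrite [q`_ _]nth_default ?mulr0 //; apply: leq_trans sq _; lia.
by rewrite [p`_ _]nth_default ?mul0r //; apply: leq_trans sp _; lia.
Qed.

Lemma lead_atD p q d a b : lead_at p d a -> lead_at q d b -> lead_at (p + q) d (a + b).
Proof.
case=> sp pd [sq qe]; split; last by rewrite coefD pd qe.
by apply: leq_trans (size_polyD _ _) _; rewrite geq_max sp.
Qed.

Lemma lead_atN p d a : lead_at p d a -> lead_at (- p) d (- a).
Proof. by case=> sp pd; split; rewrite ?size_polyN // coefN pd. Qed.

Lemma lead_atX p d a n : lead_at p d a -> lead_at (p ^+ n) (n * d) (a ^+ n).
Proof.
move=> H; elim: n => [|n IH]; first by split; rewrite ?expr0 ?size_poly1 // coefC.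
by rewrite !exprS mulSn; apply: lead_atM.
Qed.

Lemma lead_atE p d a d' a' : lead_at p d a -> d = d' -> a = a' -> lead_at p d' a'.
Proof. by move=> H <- <-. Qed.

Lemma lead_atXn n : lead_at 'X^n n 1.
Proof. by split; rewrite ?size_polyXn // coefXn eqxx. Qed.

Lemma lead_at_small (p : {poly K}) d : (size p <= d)%N -> lead_at p d 0.
Proof. by move=> sp; split; [exact: leqW | rewrite nth_default]. Qed.

Lemma lead_atZX (a : K) n : lead_at (a *: 'X^n) n a.
Proof. by split; rewrite ?coefZ ?coefXn ?eqxx ?mulr1 // (leq_trans (size_scale_leq _ _)) ?size_polyXn. Qed.

Lemma size_ZX (a : K) n d : (n < d)%N -> (size (a *: 'X^n : {poly K})%R <= d)%N.
Proof. by move=> lt; rewrite (leq_trans (size_scale_leq _ _)) ?size_polyXn. Qed.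

Lemma size_ZX1 (a : K) d : (1 < d)%N -> (size (a *: 'X : {poly K})%R <= d)%N.
Proof. by move=> lt; rewrite (leq_trans (size_scale_leq _ _)) ?size_polyX. Qed.

Lemma size_C (a : K) d : (0 < d)%N -> (size (a%:P : {poly K}) <= d)%N.
Proof. by move=> lt; rewrite (leq_trans (size_polyC_leq1 _)). Qed.

Lemma size_add_leq (p q : {poly K}) d : (size p <= d)%N -> (size q <= d)%N ->
  (size (p + q)%R <= d)%N.
Proof. by move=> sp sq; apply: leq_trans (size_polyD _ _) _; rewrite geq_max sp. Qed.

Lemma lead_at_dpF : lead_at F 3 4%:R.
Proof.
rewrite /dpF -!addrA.
apply: (@lead_atE _ _ (4%:R + 0) _ _ _ erefl (addr0 _)).
apply: lead_atD; first exact: lead_atZX.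
by apply: lead_at_small; rewrite !size_add_leq ?size_ZX ?size_ZX1 ?size_C.
Qed.

Lemma lead_at_dpf3 : lead_at (dpf3 E) 4 3%:R.
Proof.
rewrite /dpf3 -!addrA.
apply: (@lead_atE _ _ (3%:R + 0) _ _ _ erefl (addr0 _)).
apply: lead_atD; first exact: lead_atZX.
by apply: lead_at_small; rewrite !size_add_leq ?size_ZX ?size_ZX1 ?size_C.
Qed.

Lemma lead_at_dpf4 : lead_at (dpf4 E) 6 2%:R.
Proof.
rewrite /dpf4 -!addrA.
apply: (@lead_atE _ _ (2%:R + 0) _ _ _ erefl (addr0 _)).
apply: lead_atD; first exact: lead_atZX.
by apply: lead_at_small; rewrite !size_add_leq ?size_ZX ?size_ZX1 ?size_C.
Qed.

(** The degrees are [(n ^ 2 - 1) / 2] for [n = 2 k + 1] and [(n ^ 2 - 4) / 2] for [n = 2 k]. At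
    [n = 0] the subtraction truncates to 0, with coefficient 0. *)
Definition dpf_lead_at n k := 
  if odd n then lead_at (f n) (2 * k ^ 2 + 2 * k) (2 * k + 1)%:R
  else lead_at (f n) (2 * k ^ 2 - 2) k%:R.

(** Both products in the recursion have the same degree, so their coefficients subtract. From
    [n = 5] on, the truncated subtractions in the degrees are exact. *)
Lemma dpf_lead n : dpf_lead_at n n./2.
Proof.
elim/ltn_ind: n => n IH.
have [lt|n5] := ltnP n 5.
  rewrite /dpf_lead_at; case: n lt {IH} => [|[|[|[|[|n]]]]] // _ /=.
  - by rewrite dpf0; apply: lead_at_small; rewrite size_poly0.
  - by rewrite dpf1; split; rewrite ?size_poly1 // coef1.
  - by rewrite dpf2; split; rewrite ?size_poly1 // coef1.
  - exact: lead_at_dpf3.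
  exact: lead_at_dpf4.
have IHo k : (k.*2.+1 < n)%N -> lead_at (f k.*2.+1) (2 * k ^ 2 + 2 * k) (2 * k + 1)%:R.
  by move=> /IH; rewrite /dpf_lead_at /= odd_double /= uphalf_double.
have IHe k : (k.*2 < n)%N -> lead_at (f k.*2) (2 * k ^ 2 - 2) k%:R.
  by move=> /IH; rewrite /dpf_lead_at /= odd_double /= doubleK.
have nE := odd_double_half n; rewrite /dpf_lead_at (dpf_rec n5 erefl).
move: nE; move: (n./2) => m nE.
have := odd_double_half m; move: (m./2) => k mE.
have F2 := lead_atX 2 lead_at_dpF.
have nat1 a : (2 * a + 1)%:R = 2%:R * a%:R + 1 :> K by rewrite natrD natrM.
have d1 a : (a.*2.+1)%:R = 2%:R * a%:R + 1 :> K by rewrite -natr1 -mul2n natrM.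
have dbl a : (a.*2)%:R = 2%:R * a%:R :> K by rewrite -mul2n natrM.
have sK a : (a.+1)%:R = a%:R + 1 :> K by rewrite natr1.
case: (odd n) nE => nE; case: (odd m) mE => mE; move: mE nE; rewrite ?add0n ?add1n => <- nE.
- have -> : k.*2.+3 = k.+1.*2.+1 by lia.
  have -> : k.*2.+1.-1 = k.*2 by lia.
  have -> : k.*2.+2 = k.+1.*2 by lia.
  apply: lead_atE.
  + apply: lead_atD.
      by apply: lead_atM; [apply: IHo|apply/lead_atX/IHo]; lia.
    apply: lead_atN; apply: (@lead_atE _ _ _ (2 * k.+1 ^ 2 + 2 * k.+1 + 3 * (2 * k ^ 2 + 2 * k))); last reflexivity.
      by apply: lead_atM; [apply: lead_atM; [exact: F2|apply: IHe]|apply/lead_atX/IHe]; lia.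
    by case: (k) nE => [|k']; [lia|rewrite -!mulnn; lia].
  + by rewrite -!mulnn; lia.
  by rewrite ?nat1 ?d1 ?dbl sK; ring.
- have -> : k.*2.+2 = k.+1.*2 by lia.
  have -> : k.*2.-1 = k.-1.*2.+1 by lia.
  apply: lead_atE.
  + apply: lead_atD.
      by apply: lead_atM; [apply: lead_atM; [exact: F2|apply: IHe]|apply/lead_atX/IHe]; lia.
    apply: lead_atN; apply: (@lead_atE _ _ _ (2 * 3 + (2 * k.+1 ^ 2 - 2) + 3 * (2 * k ^ 2 - 2))); last reflexivity.
      by apply: lead_atM; [apply: IHo|apply/lead_atX/IHo]; lia.
    by case: (k) nE => [|k']; [lia|rewrite -!mulnn; lia].
  + by case: (k) nE => [|k']; [lia|rewrite -!mulnn; lia].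
  have [k' ->] : exists k', k = k'.+1 by exists k.-1; lia.
  by rewrite -[k'.+1.-1]/k' ?nat1 ?d1 ?dbl ?sK; ring.
- have -> : k.*2.+3 = k.+1.*2.+1 by lia.
  have -> : k.*2.+1.-1 = k.*2 by lia.
  have -> : k.*2.+1.-2 = k.-1.*2.+1 by lia.
  have -> : k.*2.+2 = k.+1.*2 by lia.
  apply: lead_atE.
  + apply: lead_atM; [by apply: IHo; lia|apply: lead_atD].
      by apply: lead_atM; [apply: IHo|apply/lead_atX/IHe]; lia.
    apply: lead_atN; apply: (@lead_atE _ _ _ (2 * k.+1 ^ 2 + 2 * k.+1 + 2 * (2 * k ^ 2 - 2))); last reflexivity.
      by apply: lead_atM; [apply: IHo|apply/lead_atX/IHe]; lia.
    by case: (k) nE => [|k']; [lia|rewrite -!mulnn; lia].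
  + by case: (k) nE => [|k']; [lia|rewrite -!mulnn; lia].
  have [k' ->] : exists k', k = k'.+1 by exists k.-1; lia.
  by rewrite -[k'.+1.-1]/k' ?nat1 ?d1 ?dbl ?sK; ring.
have -> : k.*2.-2 = k.-1.*2 by lia.
have -> : k.*2.-1 = k.-1.*2.+1 by lia.
have -> : k.*2.+2 = k.+1.*2 by lia.
apply: lead_atE.
+ apply: lead_atM; [by apply: IHe; lia|apply: lead_atD].
    by apply: lead_atM; [apply: IHe|apply/lead_atX/IHo]; lia.
  apply: lead_atN; apply: (@lead_atE _ _ _ (2 * k.+1 ^ 2 - 2 + 2 * (2 * k.-1 ^ 2 + 2 * k.-1))); last reflexivity.
    by apply: lead_atM; [apply: IHe|apply/lead_atX/IHo]; lia.
  by case: (k) nE => [|[|k']]; [lia|lia|rewrite -!mulnn; lia].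
+ by case: (k) nE => [|[|k']]; [lia|lia|rewrite -!mulnn; lia].
have [k' ->] : exists k', k = k'.+1 by exists k.-1; lia.
by rewrite -[k'.+1.-1]/k' ?nat1 ?d1 ?dbl ?sK; ring.
Qed.

Lemma lead_dpf_odd k : lead_at (f k.*2.+1) (2 * k ^ 2 + 2 * k) (2%:R * k%:R + 1).
Proof.
have := dpf_lead k.*2.+1; rewrite /dpf_lead_at /= odd_double /= uphalf_double.
by move=> H; apply: lead_atE H erefl _; rewrite natrD natrM.
Qed.

Lemma lead_dpf_even k : lead_at (f k.*2) (2 * k ^ 2 - 2) k%:R.
Proof. by have := dpf_lead k.*2; rewrite /dpf_lead_at /= odd_double /= doubleK. Qed.

Lemma lead_psi_sq n : (0 < n)%N -> lead_at (psi_sq E n) (n ^ 2 - 1) (n%:R ^+ 2).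
Proof.
move=> n0; have := odd_double_half n; move: (n./2) => k; rewrite /psi_sq.
case: (odd n) => nE; move: nE n0; rewrite ?add0n ?add1n => <- n0.
  apply: lead_atE (lead_atX 2 (lead_dpf_odd k)) _ _; first by rewrite -!mulnn; lia.
  by rewrite -[in RHS]natr1 -mul2n natrM.
have [k' Ek] : exists k', k = k'.+1 by exists k.-1; lia.
rewrite Ek; apply: lead_atE (lead_atM lead_at_dpF (lead_atX 2 (lead_dpf_even _))) _ _.
  by rewrite -!mulnn; lia.
by rewrite -mul2n natrM; ring.
Qed.

(** In degree [n ^ 2] the coefficients are [n ^ 2] for ['X * psi_sq] and [(n + 1) (n - 1)] for
    [psi_nb]; their difference is 1 in every characteristic. *)
Lemma lead_theta n : (0 < n)%N -> lead_at (theta E n) (n ^ 2) 1.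
Proof.
move=> n0; rewrite /theta.
have HX : lead_at ('X * psi_sq E n) (n ^ 2) (n%:R ^+ 2).
  apply: lead_atE (lead_atM (lead_atXn 1) (lead_psi_sq n0)) _ _; last by rewrite mul1r.
  by rewrite addnC subnK // expn_gt0 n0.
suff HN : lead_at (psi_nb E n) (n ^ 2) (n%:R ^+ 2 - 1).
  by apply: lead_atE (lead_atD HX (lead_atN HN)) erefl _; ring.
have := odd_double_half n; move: (n./2) => k; rewrite /psi_nb.
case: (odd n) => nE; move: nE n0 {HX}; rewrite ?add0n ?add1n => <- n0.
  have -> : k.*2.+2 = k.+1.*2 by lia.
  case: k n0 => [|k] n0.
    by rewrite [f _.-1]dpf0 mulr0 expr1n subrr; apply: lead_at_small; rewrite size_poly0.
  apply: lead_atE (lead_atM (lead_atM lead_at_dpF (lead_dpf_even _)) (lead_dpf_even _)) _ _.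
    by rewrite -!mulnn; lia.
  by rewrite -(natr1 k.+1.*2) -mul2n natrM -(natr1 k); ring.
have [k' Ek] : exists k', k = k'.+1 by exists k.-1; lia.
rewrite Ek; have -> : k'.+1.*2.-1 = k'.*2.+1 by lia.
apply: lead_atE (lead_atM (lead_dpf_odd _) (lead_dpf_odd _)) _ _.
  by rewrite -!mulnn; lia.
by rewrite -mul2n natrM -(natr1 k'); ring.
Qed.

End DivisionPolynomials.

Arguments dpf : simpl never.

(** * Base change of division polynomials *)

Section MapDivisionPolynomials.
Variables (K L : fieldType) (g : {rmorphism K -> L}) (E : wcurve K).
Local Notation gE := (wc_map g E).

Lemma wb2_map : wb2 gE = g (wb2 E).
Proof. by rewrite /wb2 /= !(rmorph_nat, rmorphD, rmorphM, rmorphXn) /=. Qed.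
Lemma wb4_map : wb4 gE = g (wb4 E).
Proof. by rewrite /wb4 /= !(rmorph_nat, rmorphD, rmorphM, rmorphXn) /=. Qed.
Lemma wb6_map : wb6 gE = g (wb6 E).
Proof. by rewrite /wb6 /= !(rmorph_nat, rmorphD, rmorphM, rmorphXn) /=. Qed.
Lemma wb8_map : wb8 gE = g (wb8 E).
Proof. by rewrite /wb8 /= !(rmorph_nat, rmorphD, rmorphB, rmorphN, rmorphM, rmorphXn) /=. Qed.
Definition wb_map := (wb2_map, wb4_map, wb6_map, wb8_map).

Lemma wdisc_map : wdisc gE = g (wdisc E).
Proof. by rewrite /wdisc !wb_map /= !(rmorph_nat, rmorphD, rmorphN, rmorphM, rmorphXn) /=. Qed.

Lemma is_elliptic_map : is_elliptic gE = is_elliptic E.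
Proof. by rewrite /is_elliptic wdisc_map fmorph_eq0. Qed.

Let mapE := (rmorph_nat, rmorphXn, map_polyZ, map_polyXn, map_polyX, map_polyC, rmorphD, rmorphN, rmorphM).

Lemma dpF_map : map_poly g (dpF E) = dpF gE.
Proof. by rewrite /dpF !wb_map !mapE /= ?map_polyX ?map_polyXn !mapE /=. Qed.
Lemma dpf3_map : map_poly g (dpf3 E) = dpf3 gE.
Proof. by rewrite /dpf3 !wb_map !mapE /= ?map_polyX ?map_polyXn !mapE /=. Qed.
Lemma dpf4_map : map_poly g (dpf4 E) = dpf4 gE.
Proof. by rewrite /dpf4 !wb_map !mapE /= ?map_polyX ?map_polyXn !mapE /=. Qed.

Lemma dpf_map n : map_poly g (dpf E n) = dpf gE n.
Proof.
elim/ltn_ind: n => n IH; have [lt|n5] := ltnP n 5.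
  case: n lt {IH} => [|[|[|[|[|n]]]]] // _; rewrite ?dpf0 ?dpf1 ?dpf2 ?rmorph0 ?rmorph1 //.
    exact: dpf3_map.
  exact: dpf4_map.
rewrite !(dpf_rec _ n5 erefl); case: ifP => _; [case: ifP => _|].
all: by rewrite !(rmorphB, rmorphM, rmorphXn) /= ?dpF_map !IH //; lia.
Qed.

Lemma psi_sq_map n : map_poly g (psi_sq E n) = psi_sq gE n.
Proof. by rewrite /psi_sq; case: ifP => _; rewrite ?rmorphM ?rmorphXn /= ?dpF_map ?dpf_map. Qed.

Lemma theta_map n : map_poly g (theta E n) = theta gE n.
Proof.
rewrite /theta rmorphB rmorphM /= map_polyX psi_sq_map; congr (_ - _).
by rewrite /psi_nb; case: ifP => _; rewrite ?rmorphM ?rmorphXn /= ?dpF_map ?dpf_map.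
Qed.
End MapDivisionPolynomials.

(** * The multiplication formula *)

Section SomosDpf.
Variables (K : fieldType) (E : wcurve K).
Local Notation f := (dpf E).
Local Notation F := (dpF E).
Let fr n : {fraction {poly K}} := tofrac (f n).

(** The Somos induction divides, so it takes place in the fraction field of [{poly K}]; the
    identities are then pulled back. *)
Lemma dpf_somos n : (2 <= n)%N -> (forall k, (0 < k < n)%N -> f k != 0) ->
  f n.+2 * f n.-2 = (if odd n then F ^+ 2 else 1) * f n.+1 * f n.-1 - f 3 * f n ^+ 2 /\
  f n.+2 * f n.-1 ^+ 2 + f n.-2 * f n.+1 ^+ 2 + (if odd n then 1 else F ^+ 2) * f n ^+ 3
   = dpc E * f n.-1 * f n * f n.+1.
Proof.
move=> n2 nz.
pose A := tofrac F ^+ 2; pose b := tofrac (f 3); pose c := tofrac (dpc E).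
have h0 : fr 0 = 0 by rewrite /fr dpf0 rmorph0.
have h1 : fr 1 = 1 by rewrite /fr dpf1 rmorph1.
have h2 : fr 2 = 1 by rewrite /fr dpf2 rmorph1.
have h4 : fr 4 + A = c * b by rewrite /fr /A /b /c -rmorphXn -rmorphD -rmorphM dpf4_rel.
have ho m : (2 <= m)%N ->
  fr (m.*2.+1) = alph A m.+1 * fr m.+2 * fr m ^+ 3 - alph A m * fr m.-1 * fr m.+1 ^+ 3.
  move=> m2; rewrite /fr dpf_odd // /alph /A /=.
  by case: (odd m); rewrite /= mul1r !(rmorphXn, rmorphB, rmorphM).
have he m : (3 <= m)%N ->
  fr (m.*2) = fr m * (fr m.+2 * fr m.-1 ^+ 2 - fr m.-2 * fr m.+1 ^+ 2).
  by move=> m2; rewrite /fr dpf_even // !(rmorphXn, rmorphB, rmorphM).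
have nz' : nonzero_below fr n by move=> k kn; rewrite /fr tofrac_eq0 nz.
have alE k : alph A k = tofrac (if odd k then F ^+ 2 else 1).
  by rewrite /alph; case: ifP => _; rewrite ?rmorph1 ?rmorphXn.
have := somos4_all h0 h1 h2 (erefl : fr 3 = b) ho he n2 nz'.
have := somosJ_all h0 h1 h2 (erefl : fr 3 = b) h4 ho he n2 nz'.
rewrite /somos4 /somosJ !alE /b /c /fr -!(rmorphXn, rmorphM, rmorphD, rmorphB).
move=> /eqP; rewrite tofrac_eq => /eqP HJ /eqP; rewrite tofrac_eq => /eqP HS; split=> //.
by rewrite -HJ /=; case: odd.
Qed.
End SomosDpf.

Section AddX.
Variables (K : fieldType) (E : wcurve K).
Local Notation a1 := (wa1 E). Local Notation a2 := (wa2 E).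
Local Notation a3 := (wa3 E). Local Notation a4 := (wa4 E).
Local Notation a6 := (wa6 E).
Local Notation b2 := (wb2 E). Local Notation b4 := (wb4 E).
Local Notation b6 := (wb6 E). Local Notation b8 := (wb8 E).

(* If [A : B] and x are the x-coordinates of points P and Q, then
   symS, symP and symQ are proportional to U V' + U' V, U U' and V V', where
   [U : V] and [U' : V'] are the x-coordinates of P + Q and P - Q. *)
Definition symS (x A B : K) := 2%:R * A ^+ 2 * x + 2%:R * A * B * x ^+ 2 + b2 * A * B * x
  + b4 * (A + x * B) * B + b6 * B ^+ 2.
Definition symP (x A B : K) := A ^+ 2 * x ^+ 2 - b4 * x * A * B - b6 * (A + x * B) * B - b8 * B ^+ 2.
Definition symQ (x A B : K) := (A - x * B) ^+ 2.

(** Homogeneous coordinates on the projective line, with [O] at [[1 : 0]], so that formulas cover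
    torsion points. *)
Definition px (P : pt K) : K * K := if P is Some (x, _) then (x, 1) else (1, 0).

Lemma same_x x y y' : on_curve E (Some (x, y)) -> on_curve E (Some (x, y')) ->
  y' = y \/ y' = - y - a1 * x - a3.
Proof.
move=> /eqP H /eqP H'; have : (y' - y) * (y' - (- y - a1 * x - a3)) = 0.
  have -> : (y' - y) * (y' - (- y - a1 * x - a3)) =
    (y' ^+ 2 + a1 * x * y' + a3 * y') - (y ^+ 2 + a1 * x * y + a3 * y) by ring.
  by rewrite H H' subrr.
by move/eqP; rewrite mulf_eq0 !subr_eq0 => /orP[] /eqP; [left|right].
Qed.

Lemma symS_dbl x y : on_curve E (Some (x, y)) -> symS x x 1 = psi2 E x y ^+ 2.
Proof.
move=> /eqP Hc.
have E6 : a6 = y ^+ 2 + a1 * x * y + a3 * y - (x ^+ 3 + a2 * x ^+ 2 + a4 * x).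
  by rewrite Hc; ring.
by rewrite /symS /psi2 /wb2 /wb4 /wb6 E6; ring.
Qed.

(** A Bezout identity between numerator and denominator of the duplication formula: [x (2 P)] is
    never [0 / 0] on a smooth curve. *)
Lemma sym_disc x : symS x x 1 = 0 -> symP x x 1 = 0 -> wdisc E = 0.
Proof.
move=> HS HP.
have -> : wdisc E = (- 48%:R * x ^+ 2 - 8%:R * b2 * x - 32%:R * b4 + b2 ^+ 2) * symP x x 1
   + (12%:R * x ^+ 3 - b2 * x ^+ 2 - 10%:R * b4 * x + b2 * b4 - 27%:R * b6) * symS x x 1.
  by rewrite /wdisc /symS /symP /wb2 /wb4 /wb6 /wb8; ring.
by rewrite HS HP !mulr0 addr0.
Qed.

Hypothesis hE : is_elliptic E.

Lemma px_dbl x y (U := px (addpt E (Some (x, y)) (Some (x, y)))) :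
  on_curve E (Some (x, y)) ->
  exists u, [/\ u != 0, u * U.1 = symP x x 1 & u * U.2 = symS x x 1].
Proof.
rewrite /U {U} => Hc; have HS := symS_dbl Hc.
rewrite /addpt eqxx /= -[y + y + _ + _]/(y + y + a1 * x + a3).
have -> : y + y + a1 * x + a3 = psi2 E x y by rewrite /psi2; ring.
have [p0|p0] := eqVneq (psi2 E x y) 0.
  exists (symP x x 1); rewrite /px /= mulr1 mulr0 HS p0 expr0n; split=> //.
  apply/negP => /eqP HP; move/eqP: hE; apply.
  by apply: (sym_disc (x := x)) => //; rewrite HS p0 expr0n.
exists (psi2 E x y ^+ 2); rewrite expf_neq0 // /px /= HS mulr1; split=> //.
have E6 : a6 = y ^+ 2 + a1 * x * y + a3 * y - (x ^+ 3 + a2 * x ^+ 2 + a4 * x).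
  by rewrite (eqP Hc); ring.
rewrite -/(psi2 E x y) /symP /wb4 /wb6 /wb8 E6; move: p0; rewrite /psi2 => p0.
field => //.
Qed.

(** For distinct abscissae [u] is the square of their difference. Otherwise one of [A + B], [A - B]
    is [O] and the other a double, or [A = O]. *)
Lemma sym_add A x y (B := Some (x, y)) (Z := px A) (U := px (addpt E A B)) 
    (V := px (addpt E A (opppt E B))) :
  on_curve E A -> on_curve E B ->
  exists u, [/\ u != 0, u * (U.1 * V.2 + V.1 * U.2) = symS x Z.1 Z.2,
    u * (U.1 * V.1) = symP x Z.1 Z.2 & u * (U.2 * V.2) = symQ x Z.1 Z.2].
Proof.
rewrite {}/V {}/U {}/Z {}/B; set B := Some (x, y).
case: A => [[x' y']|] HA HB; last first.
  by exists 1; rewrite /=; rewrite oner_neq0 /symS /symP /symQ; split=> //; ring.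
have [e|n] := eqVneq x' x; last first.
  rewrite /B /addpt /opppt (negPf n) /=.
  have n1 : x - x' != 0 by rewrite subr_eq0 eq_sym.
  have n2 : x' - x != 0 by rewrite subr_eq0.
  exists ((x' - x) ^+ 2); rewrite expf_neq0 //.
  have E6 : a6 = y ^+ 2 + a1 * x * y + a3 * y - (x ^+ 3 + a2 * x ^+ 2 + a4 * x).
    by rewrite (eqP HB); ring.
  have E4 : a4 = ((y' ^+ 2 + a1 * x' * y' + a3 * y' - x' ^+ 3 - a2 * x' ^+ 2) - (y ^+ 2 + a1 * x * y + a3 * y - x ^+ 3 - a2 * x ^+ 2)) / (x' - x).
    by rewrite (eqP HA) (eqP HB); field.
  rewrite /symS /symP /symQ /wb2 /wb4 /wb6 /wb8; split=> //.
  - rewrite E6 E4; field; by rewrite n1 n2.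
  - rewrite E6 E4; field; by rewrite n1 n2.
  by ring.
rewrite e in HA *; have [u [u0 HP HS]] := px_dbl HB.
have -> : symQ x x 1 = 0 by rewrite /symQ mulr1 subrr expr0n.
case: (same_x HB HA) => ->.
  exists u; have -> : addpt E B (opppt E B) = None by exact: addpt_opp.
  rewrite -/B in HP HS *; move: HP HS; case: (px (addpt E B B)) => U1 U2 /= HP HS.
  by rewrite mul1r !mulr1 !mulr0 add0r HP HS.
have -> : addpt E (Some (x, - y - a1 * x - a3)) B = None.
  by apply: addpt_opp; rewrite -opppt_cond eqxx /=; apply/eqP; ring.
have [u' [u0' HP' HS']] := px_dbl (on_curve_opp HB).
exists u'; move: HP' HS' {HP HS}; rewrite -/(opppt E B); case: (px _) => U1 U2 /= HP HS.
by rewrite ?mul0r ?mul1r ?mulr1 ?mulr0 ?add0r ?addr0 HP HS.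
Qed.

Lemma sym_scale x A B u : [/\ symS x (u * A) (u * B) = u ^+ 2 * symS x A B,
  symP x (u * A) (u * B) = u ^+ 2 * symP x A B & symQ x (u * A) (u * B) = u ^+ 2 * symQ x A B].
Proof. by rewrite /symS /symP /symQ; split; ring. Qed.

Lemma px_cases P : (px P).2 = 1 \/ (px P).1 = 1 /\ (px P).2 = 0.
Proof. by case: P => [[? ?]|]; [left|right]. Qed.

(* A pair of points of the projective line is determined by its symmetric functions. *)
Lemma sym_cancel (t1 t2 k : K) (U V : pt K) :
  t1 * (px V).2 + (px V).1 * t2 = k * ((px U).1 * (px V).2 + (px V).1 * (px U).2) ->
  t1 * (px V).1 = k * ((px U).1 * (px V).1) -> t2 * (px V).2 = k * ((px U).2 * (px V).2) ->
  t1 = k * (px U).1 /\ t2 = k * (px U).2.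
Proof.
case: (px_cases V) => [->|[-> ->]]; last first.
  by rewrite !mulr0 !mulr1 !mul1r !add0r.
rewrite !mulr1 => H1 _ H2; split=> //; apply: (addIr ((px V).1 * t2)).
by rewrite H1 H2; ring.
Qed.

Local Notation f := (dpf E).

Lemma horner_dpF x : (dpF E).[x] = 4%:R * x ^+ 3 + b2 * x ^+ 2 + 2%:R * b4 * x + b6.
Proof. by rewrite /dpF !(hornerD, hornerZ, hornerXn, hornerX, hornerC). Qed.
Lemma horner_dpc x : (dpc E).[x] = 6%:R * x ^+ 2 + b2 * x + b4.
Proof. by rewrite /dpc !(hornerD, hornerZ, hornerXn, hornerX, hornerC). Qed.
Lemma horner_dpf3 x : (f 3).[x] =
  3%:R * x ^+ 4 + b2 * x ^+ 3 + 3%:R * b4 * x ^+ 2 + 3%:R * b6 * x + b8.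
Proof. by rewrite dpf3E /dpf3 !(hornerD, hornerZ, hornerXn, hornerX, hornerC). Qed.

Lemma horner_psi_sq n x :
  (psi_sq E n).[x] = (if odd n then 1 else (dpF E).[x]) * (f n).[x] ^+ 2.
Proof. by rewrite /psi_sq; case: (odd n); rewrite ?mul1r !(horner_exp, hornerM). Qed.

Lemma horner_theta n x : (theta E n).[x] = x * (psi_sq E n).[x] -
  (if odd n then (dpF E).[x] else 1) * (f n.+1).[x] * (f n.-1).[x].
Proof.
rewrite /theta hornerD hornerN hornerM hornerX /psi_nb.
by case: (odd n); rewrite ?mul1r !hornerM.
Qed.

(** The outer terms [s = f n.+2] and [t = f n.-2] enter only through [s p ^ 2 + t r ^ 2] and [s t],
    where [p = f n.-1] and [r = f n.+1]; [somosJ] gives the first and [somos4] the second. *)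
Lemma theta_rec n x : (2 <= n)%N -> (forall k, (0 < k < n)%N -> f k != 0) ->
  let T k := (theta E k).[x] in let Y k := (psi_sq E k).[x] in
  [/\ T n.+1 * Y n.-1 + T n.-1 * Y n.+1 = symS x (T n) (Y n),
      T n.+1 * T n.-1 = symP x (T n) (Y n) & Y n.+1 * Y n.-1 = symQ x (T n) (Y n)].
Proof.
move=> n2 nz /=; have [/(congr1 (horner^~ x)) HS /(congr1 (horner^~ x)) HJ] := dpf_somos n2 nz.
have HS' : (f n.+2).[x] * (f n.-2).[x] = (if odd n then (dpF E).[x] ^+ 2 else 1) * (f n.+1).[x] * (f n.-1).[x]
   - (f 3).[x] * (f n).[x] ^+ 2.
  move: HS; move: (f 3) (dpF E) => b F; rewrite !(horner_exp, hornerD, hornerN, hornerM) => ->.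
  by case: (odd n); rewrite ?hornerC ?horner_exp.
have HJ' : (f n.+2).[x] * (f n.-1).[x] ^+ 2 + (f n.-2).[x] * (f n.+1).[x] ^+ 2 +
   (if odd n then 1 else (dpF E).[x] ^+ 2) * (f n).[x] ^+ 3 = (dpc E).[x] * (f n.-1).[x] * (f n).[x] * (f n.+1).[x].
  move: HJ; move: (dpc E) (dpF E) => c F; rewrite !(horner_exp, hornerD, hornerN, hornerM) => <-.
  by case: (odd n); rewrite ?hornerC ?horner_exp.
rewrite !horner_theta !horner_psi_sq prednK; last by lia.
have -> : odd n.-1 = ~~ odd n by case: (n) n2 => //= m _; rewrite negbK.
move: HS' HJ' {HS HJ}; rewrite horner_dpf3 horner_dpc [odd n.+1]/= horner_dpF.
move: (f n.+2).[x] (f n.-2).[x] (f n.+1).[x] (f n.-1).[x] (f n).[x] => s t r p q.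
rewrite /symS /symP /symQ; set F := 4%:R * _ + _ + _ + _; set c := 6%:R * _ + _ + _.
case: (odd n) => /= HS HJ; split; try ring.
- transitivity (F * (2%:R * x * F * r ^+ 2 * p ^+ 2 - q * (s * p ^+ 2 + t * r ^+ 2))); first ring.
  have -> : s * p ^+ 2 + t * r ^+ 2 = c * p * q * r - q ^+ 3 by rewrite -HJ; ring.
  by rewrite /F /c; ring.
- transitivity (x ^+ 2 * F ^+ 2 * r ^+ 2 * p ^+ 2 - x * F * q * (s * p ^+ 2 + t * r ^+ 2) + q ^+ 2 * (s * t)); first ring.
  have -> : s * p ^+ 2 + t * r ^+ 2 = c * p * q * r - q ^+ 3 by rewrite -HJ; ring.
  by rewrite HS /F /c; ring.
- transitivity (2%:R * x * r ^+ 2 * p ^+ 2 - F * q * (s * p ^+ 2 + t * r ^+ 2)); first ring.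
  have -> : s * p ^+ 2 + t * r ^+ 2 = c * p * q * r - F ^+ 2 * q ^+ 3 by rewrite -HJ; ring.
  by rewrite /F /c; ring.
transitivity (x ^+ 2 * r ^+ 2 * p ^+ 2 - x * F * q * (s * p ^+ 2 + t * r ^+ 2) + F ^+ 2 * q ^+ 2 * (s * t)); first ring.
have -> : s * p ^+ 2 + t * r ^+ 2 = c * p * q * r - F ^+ 2 * q ^+ 3 by rewrite -HJ; ring.
by rewrite HS /F /c; ring.
Qed.

(** The pair of [(n + 2) R + R] and [(n + 2) R - R] is known by its symmetric functions, and its
    second member by induction, which leaves the first. *)
Lemma mulpt_px n x y : (0 < n)%N -> (forall k, (0 < k < n)%N -> f k != 0) ->
  on_curve E (Some (x, y)) ->
  exists u, [/\ u != 0, (theta E n).[x] = u * (px (mulpt E n (Some (x, y)))).1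
     & (psi_sq E n).[x] = u * (px (mulpt E n (Some (x, y)))).2].
Proof.
move=> n0 nz Hc; set B := Some (x, y) in Hc *.
pose P : epoint hE := exist (fun P => on_curve E P) B Hc.
have mE k : mulpt E k B = val (P *+ k) by rewrite val_epointMn.
elim/ltn_ind: n n0 nz => -[|[|[|n]]] // IH _ nz.
- exists 1; rewrite oner_neq0 mE /theta /psi_sq /psi_nb /= mulr1 !mul1r dpf0 dpf1 dpf2.
  by rewrite mulr0 subr0 expr1n mulr1 hornerX hornerC.
- have [u [u0 H1 H2]] := px_dbl Hc.
  exists u; rewrite mE mulr2n val_epointD -/B H1 H2; split=> //.
    rewrite horner_theta horner_psi_sq /= horner_dpF horner_dpf3 dpf1 dpf2 hornerC /symP.
    by ring.
  by rewrite horner_psi_sq /= horner_dpF dpf2 hornerC /symS; ring.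
have nz' m : (m < n.+3)%N -> forall k, (0 < k < m)%N -> f k != 0 by move=> lt k kn; apply: nz; lia.
have [u [u0 H1 H2]] := IH n.+2 (leqnn _) isT (nz' n.+2 (leqnn _)).
have [v [v0 K1 K2]] := IH n.+1 (leqW (leqnn _)) isT (nz' n.+1 (leqW (leqnn _))).
have [T1 T2 T3] := theta_rec x (isT : (2 <= n.+2)%N) (nz' n.+2 (leqnn _)).
have HA : on_curve E (mulpt E n.+2 B) by rewrite mE; apply: valP.
have [w [w0]] := sym_add HA Hc.
have -> : addpt E (mulpt E n.+2 B) (Some (x, y)) = mulpt E n.+3 B.
  by rewrite !mE -[Some _]/(val P) -val_epointD -mulrSr.
have -> : addpt E (mulpt E n.+2 B) (opppt E (Some (x, y))) = mulpt E n.+1 B.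
  by rewrite !mE -[Some _]/(val P) -val_epointN -val_epointD mulrSr addrK.
have [S1 S2 S3] := sym_scale x (px (mulpt E n.+2 B)).1 (px (mulpt E n.+2 B)).2 u.
rewrite [n.+2.-1]/= H1 H2 S1 S2 S3 K1 K2 in T1 T2 T3.
move=> W1 W2 W3; rewrite -W1 -W2 -W3 in T1 T2 T3.
(* The symmetric functions are quadratic in the coordinates at [n + 2], whence [u ^ 2]; [w] comes
   from [sym_add], and [v] is the factor at [n + 1]. *)
exists (u ^+ 2 * w / v); have uw : u ^+ 2 * w / v != 0 by rewrite !mulf_neq0 ?invr_eq0 ?expf_neq0.
have [] := @sym_cancel (theta E n.+3).[x] (psi_sq E n.+3).[x] (u ^+ 2 * w / v) (mulpt E n.+3 B) (mulpt E n.+1 B).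
- by apply: (mulfI v0); transitivity (u ^+ 2 * (w *
   ((px (mulpt E n.+3 B)).1 * (px (mulpt E n.+1 B)).2 + (px (mulpt E n.+1 B)).1 * (px (mulpt E n.+3 B)).2))); [rewrite -T1; ring|field].
- by apply: (mulfI v0); transitivity (u ^+ 2 * (w *
   ((px (mulpt E n.+3 B)).1 * (px (mulpt E n.+1 B)).1))); [rewrite -T2; ring|field].
- by apply: (mulfI v0); transitivity (u ^+ 2 * (w *
   ((px (mulpt E n.+3 B)).2 * (px (mulpt E n.+1 B)).2))); [rewrite -T3; ring|field].
by move=> -> ->.
Qed.
End AddX.

(** * Splitting fields *)

Lemma irreducible_divisor (F : fieldType) (p : {poly F}) : (1 < size p)%N ->
  exists2 q, q %| p & irreducible_poly q.
Proof.
have [n] := ubnP (size p); elim: n p => // n IH p lt s1.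
(* Over an arbitrary field irreducibility is no boolean test, hence excluded middle. *)
have [irr|nirr] := classic (irreducible_poly p); first by exists p.
have [q [q1 qp nqp]] : exists q : {poly F}, [/\ size q != 1%N, q %| p & ~~ (q %= p)].
  apply: NNPP => H; apply: nirr; split=> // q q1 qp; apply: contraT => nqp.
  by case: H; exists q.
have p0 : p != 0 by rewrite -size_poly_gt0 (ltn_trans _ s1).
have q0 : q != 0 by apply: contraTneq qp => ->; rewrite dvd0p.
have ltq : (size q < size p)%N.
  by rewrite ltn_neqAle dvdp_leq // andbT; apply: contra nqp; rewrite dvdp_size_eqp.
have [|//|r rq irr] := IH q.
- exact: leq_trans ltq lt.
- by rewrite ltn_neqAle eq_sym q1 size_poly_gt0.
by exists r => //; apply: dvdp_trans qp.
Qed.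

Lemma split_ext (F : fieldType) (p : {poly F}) : p != 0 ->
  exists (L : fieldExtType F) (zs : seq L), map_poly (in_alg L) p %= \prod_(z <- zs) ('X - z%:P).
Proof.
have [n] := ubnP (size p); elim: n => // n IHn in F p * => lbn nz_p.
have [Cp|C'p] := leqP (size p) 1.
  exists F^o, [::].
  by rewrite big_nil -size_poly_eq1 size_map_poly eqn_leq Cp size_poly_gt0.
have [r r_dv_p irr_r] := irreducible_divisor C'p.
have [K _ [x rx0 defK]] := irredp_FAdjoin irr_r.
have [q Dp] : exists q, map_poly (in_alg K) p = q * ('X - x%:P).
  by apply/factor_theorem; rewrite -(divpK r_dv_p) rmorphM rootM rx0 orbT.
have Dszp: size p = size (q * ('X - x%:P)) by rewrite -Dp size_map_poly.
have nz_q: q != 0.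
  by move: nz_p; rewrite -size_poly_eq0 Dszp size_poly_eq0 mulf_eq0 => /norP[].
have [|L [zs Dq]] := IHn K q _ nz_q.
  by move: lbn; rewrite Dszp size_mul ?polyXsubC_eq0 // size_XsubC addn2.
exists (baseFieldType L), (x%:A :: zs).
have -> : map_poly (in_alg (baseFieldType L)) p = map_poly (in_alg L) (map_poly (in_alg K) p).
  rewrite -map_poly_comp; apply: eq_map_poly => a /=; exact: baseField_scaleE.
rewrite big_cons Dp mulrC rmorphM /= map_polyXsubC /= eqp_mull //.
Qed.

(** A field in which [p] splits need not be normal over [F]; the subfield generated by the roots
    is. *)
Lemma splitting_field_exists (F : fieldType) (p : {poly F}) : p != 0 ->
  exists (L : splittingFieldType F) (zs : seq L), map_poly (in_alg L) p %= \prod_(z <- zs) ('X - z%:P).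
Proof.
move=> nz_p; have [L [ys Dp]] := split_ext nz_p.
pose Lp := subvs_of <<1 & ys>>; pose toL := linfun (vsval : Lp -> L).
have [zs Dys]: exists zs, map toL zs = ys.
  exists (map (vsproj _) ys); rewrite -map_comp map_id_in // => y ys_y.
  by rewrite /= lfunE /= vsprojK ?seqv_sub_adjoin.
have Dpz : map_poly (in_alg Lp) p %= \prod_(z <- zs) ('X - z%:P).
  set lhs := (lhs in lhs %= _); set rhs := (rhs in _ %= rhs).
  suffices: map_poly toL lhs %= map_poly toL rhs by rewrite eqp_map.
  rewrite -Dys big_map in Dp; apply: etrans Dp; apply: congr2.
    by rewrite -map_poly_comp; apply/eq_map_poly=> x; apply: rmorph_alg.
  by rewrite /rhs map_prod_XsubC.
have axLp : SplittingField.axiom Lp.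
  exists (map_poly (in_alg Lp) p).
    by apply/polyOverP => i; rewrite coef_map memvZ ?mem1v.
  exists zs => //.
  set Lzs := LHS; pose Lys := (toL @: Lzs)%VS; apply/vspaceP=> u.
  have: val u \in Lys by rewrite /Lys aimg_adjoin_seq aimg1 Dys (valP u).
  by case/memv_imgP=> v Lzs_v; rewrite memvf lfunE => /val_inj->.
pose SL : splittingFieldType F := HB.pack Lp (FieldExt_isSplittingField.Build F Lp axLp).
by exists SL, zs.
Qed.

Lemma root_ext (F : fieldType) (p : {poly F}) : (1 < size p)%N ->
  exists (L : fieldType) (g : {rmorphism F -> L}) (z : L), root (map_poly g p) z.
Proof.
move=> /irreducible_divisor [q qp /irredp_FAdjoin [L _ [z rz _]]].
exists L, (in_alg L), z; move: rz; rewrite !root_factor_theorem => /dvdp_trans; apply.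
by rewrite dvdp_map.
Qed.

Lemma lead_at_size (K : fieldType) (p : {poly K}) d a : lead_at p d a -> a != 0 -> size p = d.+1.
Proof.
case=> sp pd a0; apply/eqP; rewrite eqn_leq sp ltnNge; apply/negP => le.
by move: a0; rewrite -pd nth_default ?eqxx.
Qed.

Lemma lead_at_deriv (K : fieldType) (p : {poly K}) d a :
  lead_at p d.+1 a -> lead_at p^`() d (a *+ d.+1).
Proof.
case=> sp pd; split; last by rewrite coef_deriv pd.
by apply: leq_trans (size_poly _ _) _; move: sp; case: (size p).
Qed.

Lemma split_root (L : fieldType) (p : {poly L}) (zs : seq L) :
  p %| \prod_(z <- zs) ('X - z%:P) -> (1 < size p)%N -> exists2 y, root p y & y \in zs.
Proof.
move=> /dvdp_prod_XsubC [m Hm] s1; have := eqp_size Hm; rewrite size_prod_XsubC => sm.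
case E : (mask m zs) sm Hm => [|y r] sm Hm; first by rewrite sm in s1.
exists y; first by rewrite (eqp_root Hm) root_prod_XsubC mem_head.
by apply: (mem_mask (m := m)); rewrite E mem_head.
Qed.

Section YPoly.
Variables (K : fieldType) (E : wcurve K).

Definition ypoly (x : K) : {poly K} := 'X^2 + (wa1 E * x + wa3 E) *: 'X
  - (x ^+ 3 + wa2 E * x ^+ 2 + wa4 E * x + wa6 E)%:P.

Lemma root_ypoly x y : root (ypoly x) y = on_curve E (Some (x, y)).
Proof.
rewrite /root /ypoly !(hornerD, hornerN, hornerZ, hornerXn, hornerX, hornerC) subr_eq0.
by congr (_ == _); ring.
Qed.

Lemma lead_at_ypoly x : lead_at (ypoly x) 2 1.
Proof.
rewrite /ypoly; apply: (@lead_atE _ _ 2 (1 + 0) _ _ _ erefl (addr0 _)).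
rewrite -addrA; apply: lead_atD; first exact: lead_atXn.
by apply: lead_at_small; rewrite -polyCN size_add_leq ?size_ZX1 ?size_C.
Qed.

Lemma size_ypoly x : size (ypoly x) = 3%N.
Proof. exact: lead_at_size (lead_at_ypoly x) (oner_neq0 _). Qed.

Lemma ypoly_neq0 x : ypoly x != 0.
Proof. by rewrite -size_poly_gt0 size_ypoly. Qed.
End YPoly.

Lemma ypoly_map (K L : fieldType) (g : {rmorphism K -> L}) (E : wcurve K) x :
  map_poly g (ypoly E x) = ypoly (wc_map g E) (g x).
Proof.
rewrite /ypoly rmorphB rmorphD /= map_polyXn map_polyC map_polyZ /= map_polyX.
by rewrite !(rmorphXn, rmorphD, rmorphM).
Qed.

Lemma point_ext (K : fieldType) (E : wcurve K) (x : K) :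
  exists (L : fieldType) (g : {rmorphism K -> L}) (y : L), on_curve (wc_map g E) (Some (g x, y)).
Proof.
have [|L [g [y ry]]] := @root_ext _ (ypoly E x); first by rewrite size_ypoly.
by exists L, g, y; rewrite -root_ypoly -ypoly_map.
Qed.

Lemma points_ext (K : fieldType) (E : wcurve K) (s : seq K) :
  exists (L : fieldType) (g : {rmorphism K -> L}), forall x, x \in s ->
  exists y : L, on_curve (wc_map g E) (Some (g x, y)).
Proof.
have [|L [zs Hzs]] := @split_ext _ (\prod_(x <- s) ypoly E x).
  by rewrite prodf_seq_neq0; apply/allP => x _; rewrite -size_poly_gt0 size_ypoly.
exists L, (in_alg L) => x xs.
have [||y ry _] := @split_root _ (ypoly (wc_map (in_alg L) E) (in_alg L x)) zs.
- rewrite -(eqp_dvdr _ Hzs) -ypoly_map dvdp_map (big_rem x) //= dvdp_mulr //.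
- by rewrite size_ypoly.
by exists y; rewrite -root_ypoly.
Qed.

(** Some extension has a point above [z], and there the two values are a nonzero multiple of
    homogeneous coordinates. The nonvanishing is therefore assumed over all fields. *)
Lemma psi_theta_neq0_step n : (0 < n)%N ->
  (forall (K : fieldType) (E : wcurve K) k, is_elliptic E -> (0 < k < n)%N -> dpf E k != 0) ->
  forall (K : fieldType) (E : wcurve K) z, is_elliptic E ->
  ~ ((theta E n).[z] = 0 /\ (psi_sq E n).[z] = 0).
Proof.
move=> n0 nz K E z hE [Ht Hp].
have [L [g [y Hy]]] := point_ext E z.
have hE' : is_elliptic (wc_map g E) by rewrite is_elliptic_map.
have [u [u0]] := mulpt_px hE' n0 (fun k => nz _ _ k hE') Hy.
rewrite -theta_map -psi_sq_map !horner_map Ht Hp rmorph0 => /esym/eqP H1 /esym/eqP H2.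
move: H1 H2; rewrite !mulf_eq0 (negPf u0) /=.
by set V := mulpt _ _ _; case: (px_cases V) => [->|[-> _]]; rewrite oner_eq0.
Qed.

(* If [dpf E n] vanished, so would [psi_sq E n], while [theta E n] is not constant. *)
Lemma dpf_neq0 (K : fieldType) (E : wcurve K) n : is_elliptic E -> (0 < n)%N -> dpf E n != 0.
Proof.
elim/ltn_ind: n K E => n IH K E hE n0.
have nz (K' : fieldType) (E' : wcurve K') k : is_elliptic E' -> (0 < k < n)%N -> dpf E' k != 0.
  by move=> hE' /andP[k0 kn]; apply: IH.
apply/eqP => fn0.
have st : size (theta E n) = (n ^ 2).+1 := lead_at_size (lead_theta E n0) (oner_neq0 _).
have [|L [g [z rz]]] := @root_ext _ (theta E n); first by rewrite st ltnS expn_gt0 n0.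
have hE' : is_elliptic (wc_map g E) by rewrite is_elliptic_map.
apply: (@psi_theta_neq0_step n n0 nz L (wc_map g E) z hE'); split.
  by rewrite -theta_map; apply/eqP.
by rewrite horner_psi_sq -dpf_map fn0 rmorph0 horner0 expr0n mulr0.
Qed.

Lemma psi_theta_neq0 (K : fieldType) (E : wcurve K) n z : is_elliptic E -> (0 < n)%N ->
  ~ ((theta E n).[z] = 0 /\ (psi_sq E n).[z] = 0).
Proof.
move=> hE n0; apply: psi_theta_neq0_step => // K' E' k hE' /andP[k0 _]; exact: dpf_neq0.
Qed.

Section MultiplicationFormula.
Variables (K : fieldType) (E : wcurve K) (hE : is_elliptic E).

Lemma mul_px n x y : (0 < n)%N -> on_curve E (Some (x, y)) ->
  exists u, [/\ u != 0, (theta E n).[x] = u * (px (mulpt E n (Some (x, y)))).1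
     & (psi_sq E n).[x] = u * (px (mulpt E n (Some (x, y)))).2].
Proof. by move=> n0; apply: mulpt_px => // k /andP[k0 _]; apply: dpf_neq0. Qed.

Lemma root_psi_sq n x y : (0 < n)%N -> on_curve E (Some (x, y)) ->
  root (psi_sq E n) x = (mulpt E n (Some (x, y)) == None).
Proof.
move=> n0 Hc; have [u [u0 _ H]] := mul_px n0 Hc.
rewrite /root H mulf_eq0 (negPf u0) /=.
by case: (mulpt _ _ _) => [[x' y']|] /=; rewrite ?oner_eq0 ?eqxx.
Qed.

Lemma on_curve_mul n P : on_curve E P -> on_curve E (mulpt E n P).
Proof. by move=> HP; elim: n => //= n IH; apply: on_curve_add. Qed.

Lemma root_delta n x y P : (0 < n)%N -> on_curve E (Some (x, y)) -> on_curve E P -> P != None ->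
  root (delta E n P) x <-> mulpt E n (Some (x, y)) = P \/ mulpt E n (Some (x, y)) = opppt E P.
Proof.
case: P => [[xP yP]|] // n0 Hc HP _; have [u [u0 H1 H2]] := mul_px n0 Hc.
have HR := on_curve_mul n Hc.
rewrite /delta /root hornerD hornerN hornerZ H1 H2 mulrCA -mulrBr mulf_eq0 (negPf u0) /=.
case: (mulpt _ _ _) HR => [[x' y']|] HR; rewrite /px /=; last first.
  by rewrite mulr0 subr0 oner_eq0; split => // -[].
rewrite mulr1 subr_eq0; split=> [/eqP e|[[-> _]|[-> _]]] //.
by rewrite e in HR *; case: (same_x HP HR) => ->; [left|right].
Qed.

Lemma lead_delta n P : (0 < n)%N -> P != None -> lead_at (delta E n P) (n ^ 2) 1.
Proof.
case: P => [[xP yP]|] // n0 _; rewrite /delta.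
apply: (@lead_atE _ _ _ (1 + 0) _ _ _ erefl (addr0 _)).
apply: lead_atD; first exact: lead_theta.
apply: lead_at_small; rewrite size_polyN; apply: leq_trans (size_scale_leq _ _) _.
by have [+ _] := lead_psi_sq E n0; rewrite -{2}(subnK (_ : 1 <= n ^ 2)%N) ?addn1 // expn_gt0 n0.
Qed.
End MultiplicationFormula.

(** * Counting torsion points *)

Lemma natf_map (K L : fieldType) (g : {rmorphism K -> L}) n : ((n%:R : K) != 0) -> (n%:R : L) != 0.
Proof. by rewrite -(rmorph_nat g) fmorph_eq0. Qed.

(** The [l ^ N]-th roots of unity are distinct because [l] is invertible; this provides enough
    elements even over a finite field. *)
Lemma big_ext (K : fieldType) l N : (1 < l)%N -> (l%:R : K) != 0 ->
  exists (L : fieldExtType K) (rs : seq L), uniq rs /\ (N < size rs)%N.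
Proof.
move=> l1 l0; have lN0 : (0 < l ^ N)%N by rewrite expn_gt0 (ltn_trans _ l1).
have [|L [rs Hrs]] := @split_ext K ('X^(l ^ N) - 1).
  by rewrite -size_poly_gt0 size_Xn_sub_1.
rewrite rmorphB /= map_polyXn rmorph1 in Hrs; exists L, rs; split.
  rewrite -separable_prod_XsubC -(eqp_separable Hrs) cyclotomic.separable_Xn_sub_1 //.
  by rewrite natrX expf_neq0 // (natf_map (in_alg L)).
have := eqp_size Hrs; rewrite size_Xn_sub_1 // size_prod_XsubC => -[<-].
exact: ltn_expl.
Qed.

(** At a multiple root [t = c q] and [t' = c q'], so the multiple points of any fibre of [t / q] are
    zeros of the Wronskian. *)
Lemma wronsk_pencil (K : fieldType) (t q : {poly K}) c z :
  root (t - c *: q) z -> root (t - c *: q)^`() z ->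
  root (t^`() * q - t * q^`()) z /\ t.[z] = c * q.[z].
Proof.
rewrite /root !(derivD, derivN, derivZ) !(hornerD, hornerN, hornerM, hornerZ) !subr_eq0.
by move=> /eqP -> /eqP ->; split=> //; apply/eqP; ring.
Qed.

Section TorsionCount.
Variables (K : fieldType) (E : wcurve K) (l : nat).
Hypotheses (l1 : (1 < l)%N) (l0 : (l%:R : K) != 0).
Let l_gt0 : (0 < l)%N. Proof. exact: ltn_trans l1. Qed.

Definition wronsk (L : fieldType) (E' : wcurve L) : {poly L} :=
  (theta E' l)^`() * psi_sq E' l - theta E' l * (psi_sq E' l)^`().

(** The coefficient in degree [2 l ^ 2 - 2] is [l ^ 2 * l ^ 2 - (l ^ 2 - 1) * l ^ 2 = l ^ 2]. *)
Lemma wronsk_neq0 : wronsk E != 0.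
Proof.
have [d Ed] : exists d, (l ^ 2 = d.+2)%N by exists (l ^ 2 - 2)%N; rewrite -mulnn; nia.
have Ht := lead_theta E l_gt0; have Hp := lead_psi_sq E l_gt0.
rewrite Ed in Ht Hp; rewrite subSS subn0 in Hp.
have HW := lead_atD (lead_atM (lead_at_deriv Ht) Hp)
   (lead_atN (lead_atE (lead_atM Ht (lead_at_deriv Hp)) (addSnnS d.+1 d) erefl)).
rewrite addnS in HW.
rewrite -size_poly_gt0 (lead_at_size HW) //.
have -> : 1 *+ d.+2 * l%:R ^+ 2 - 1 * (l%:R ^+ 2 *+ d.+1) = l%:R ^+ 2 :> K.
  by rewrite mulrnAl !mul1r [_ *+ d.+2]mulrS addrK.
exact: expf_neq0.
Qed.

Lemma wronsk_map (L : fieldType) (g : {rmorphism K -> L}) :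
  map_poly g (wronsk E) = wronsk (wc_map g E).
Proof. by rewrite /wronsk rmorphB !rmorphM /= -!deriv_map theta_map psi_sq_map. Qed.

Hypothesis hE : is_elliptic E.

Lemma wronsk_root (c z : K) (p := theta E l - c *: psi_sq E l) :
  root p z -> root p^`() z -> root (wronsk E) z /\ c = (theta E l).[z] / (psi_sq E l).[z].
Proof.
move=> r1 r2; have [HW Ht] := wronsk_pencil r1 r2; split=> //.
have p0 : (psi_sq E l).[z] != 0.
  apply/eqP => H; apply: (@psi_theta_neq0 _ E l z hE l_gt0).
  by rewrite Ht H mulr0.
by rewrite Ht mulfK.
Qed.
End TorsionCount.

Lemma separable_fiber (K : fieldType) (E : wcurve K) l : is_elliptic E -> (1 < l)%N -> (l%:R : K) != 0 ->
  exists (L : fieldType) (g : {rmorphism K -> L}) (c : L) (zs : seq L),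
    [/\ uniq zs, size zs = (l ^ 2)%N &
     forall z, z \in zs -> root (theta (wc_map g E) l - c *: psi_sq (wc_map g E) l) z].
Proof.
move=> hE l1 l0; have l_gt0 : (0 < l)%N by apply: ltn_trans l1.
have [L1 [ws Hws]] := split_ext (wronsk_neq0 E l1 l0).
have [L2 [rs [Urs Srs]]] := big_ext (size ws) l1 (natf_map (in_alg L1) l0).
pose g2 : {rmorphism K -> L2} := in_alg L2 \o in_alg L1.
pose E2 := wc_map g2 E.
(* The critical values of [theta / psi_sq]. They are at most [size ws] many, and [rs] has more
   elements, so some [c] avoids them. *)
pose bad := [seq (theta E2 l).[in_alg L2 w] / (psi_sq E2 l).[in_alg L2 w] | w <- ws].
have [c [crs cbad]] : exists c, c \in rs /\ c \notin bad.
  have [/allP H|/allPn [c c1 c2]] := boolP (all (mem bad) rs); last by exists c.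
  by have := uniq_leq_size Urs H; rewrite size_map leqNgt Srs.
pose p := theta E2 l - c *: psi_sq E2 l.
have sp : size p = (l ^ 2).+1.
  apply: (@lead_at_size _ _ _ 1); last exact: oner_neq0.
  rewrite /p; apply: (@lead_atE _ _ _ (1 + 0) _ _ _ erefl (addr0 _)).
  apply: lead_atD; first exact: lead_theta.
  apply: lead_at_small; rewrite size_polyN; apply: leq_trans (size_scale_leq _ _) _.
  by have [+ _] := lead_psi_sq E2 l_gt0; rewrite subn1 prednK // expn_gt0 l_gt0.
have p0 : p != 0 by rewrite -size_poly_gt0 sp.
have [L [zs Hzs]] := split_ext p0.
pose g : {rmorphism K -> L} := in_alg L \o g2.
have EE : wc_map g E = wc_map (in_alg L) E2 by [].
have mp : map_poly (in_alg L) p = theta (wc_map g E) l - in_alg L c *: psi_sq (wc_map g E) l.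
  by rewrite /p rmorphB /= map_polyZ /= theta_map psi_sq_map EE.
exists L, g, (in_alg L c), zs; split.
- rewrite -separable_prod_XsubC -(eqp_separable Hzs) separable_map unlock.
  (* A multiple root, found in an extension [M], would be a zero of the Wronskian, hence come from
     [ws], and [c] would be critical. *)
  apply: contraT; rewrite /coprimep => nsp.
  have [|M [h [z]]] := @root_ext _ (gcdp p p^`()).
    rewrite ltn_neqAle eq_sym nsp size_poly_gt0 gcdp_eq0 negb_and p0 //.
  rewrite gcdp_map root_gcd -deriv_map => /andP[r1 r2].
  have hE' : is_elliptic (wc_map h E2) by rewrite !is_elliptic_map.
  have mp' : map_poly h p = theta (wc_map h E2) l - h c *: psi_sq (wc_map h E2) l.
    by rewrite /p rmorphB /= map_polyZ /= theta_map psi_sq_map.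
  rewrite mp' in r1 r2; have [r3 Ec] := wronsk_root l1 hE' r1 r2.
  have : z \in [seq h (in_alg L2 w) | w <- ws].
    move: r3; have -> : wronsk l (wc_map h E2) = map_poly (h \o in_alg L2) (map_poly (in_alg L1) (wronsk l E)).
      by rewrite !wronsk_map.
    rewrite root_factor_theorem; move: Hws; rewrite -(eqp_map (h \o in_alg L2)) => /eqp_dvdr ->.
    by rewrite map_prod_XsubC -(big_map _ xpredT (fun x => 'X - x%:P)) -root_factor_theorem root_prod_XsubC.
  case/mapP => w wws Ez; case/negP: cbad; apply/mapP; exists w => //.
  apply: (fmorph_inj h); rewrite Ec Ez fmorph_div -!horner_map; congr (_.[_] / _.[_]).
    by rewrite -theta_map.
  by rewrite -psi_sq_map.
- by have := eqp_size Hzs; rewrite size_map_poly sp size_prod_XsubC => -[<-].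
by move=> z zzs; rewrite -mp (eqp_root Hzs) root_prod_XsubC.
Qed.

(** Above each of the [l ^ 2] abscissae of a separable fibre lies a point with [l R = P], after a
    choice of sign. Subtracting one of these points from all gives the torsion points. *)
Lemma torsion_ext (K : fieldType) (E : wcurve K) l : is_elliptic E -> (1 < l)%N -> (l%:R : K) != 0 ->
  exists (L : fieldType) (g : {rmorphism K -> L}) (s : seq (option (L * L))), 
    [/\ uniq s, size s = (l ^ 2)%N &
     forall T, T \in s -> on_curve (wc_map g E) T /\ mulpt (wc_map g E) l T = None].
Proof.
move=> hE l1 l0; have l_gt0 : (0 < l)%N by apply: ltn_trans l1.
have [L1 [g1 [c [zs [Uzs Szs Rzs]]]]] := separable_fiber hE l1 l0.
have [L [h Hys]] := points_ext (wc_map g1 E) (c :: zs).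
pose g : {rmorphism K -> L} := h \o g1; pose E' := wc_map g E.
have hE' : is_elliptic E' by rewrite is_elliptic_map.
have [yc Hc] := Hys _ (mem_head _ _).
pose P : epoint hE' := exist (fun P => on_curve E' P) (Some (h c, yc)) Hc.
have [Rs [HRs HP]] : exists Rs : seq (epoint hE'), map (fun R => px (val R)) Rs = map (fun z => (h z, 1)) zs
    /\ forall R, R \in Rs -> R *+ l = P.
  have {Uzs Szs} : forall z, z \in zs -> exists R : epoint hE', px (val R) = (h z, 1) /\ R *+ l = P.
    move=> z zzs; have [|y Hy] := Hys z; first by rewrite inE zzs orbT.
    pose R : epoint hE' := exist (fun P => on_curve E' P) (Some (h z, y)) Hy.
    have : root (delta E' l (val P)) (h z).
      by have := Rzs z zzs; rewrite -(fmorph_root h) rmorphB /= map_polyZ theta_map psi_sq_map.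
    move=> /(root_delta hE' l_gt0 Hy Hc isT) [] H.
      exists R; split=> //; apply: val_inj; rewrite val_epointMn. exact: H.
    exists (- R); split=> //; rewrite mulNrn; apply: (can_inj opprK).
    rewrite opprK; apply: val_inj; rewrite val_epointMn; exact: H.
  elim: zs {Rzs Hys} => [|z zs IH] H; first by exists [::].
  have [Rs [HRs HP]] : exists Rs : seq (epoint hE'), map (fun R => px (val R)) Rs = map (fun z => (h z, 1)) zs
    /\ forall R, R \in Rs -> R *+ l = P.
    by apply: IH => w ws; apply: H; rewrite inE ws orbT.
  have [R [HR HlR]] := H z (mem_head _ _).
  exists (R :: Rs); split; first by rewrite /= HRs HR.
  by move=> R'; rewrite inE => /orP[/eqP -> //|]; apply: HP.
have URs : uniq Rs.
  apply: (@map_uniq _ _ (fun R => px (val R))); rewrite HRs map_inj_uniq // => a b [].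
  exact: fmorph_inj.
have SRs : size Rs = (l ^ 2)%N by rewrite -Szs -(size_map (fun R => px (val R))) HRs size_map.
have [R0 HR0] : exists R0, R0 \in Rs.
  case: (Rs) SRs => [|R0 Rs' _]; last by exists R0; rewrite mem_head.
  by move=> /eqP; rewrite eq_sym expn_eq0; case: (l) l_gt0.
exists L, g, [seq val (R - R0) | R <- Rs]; split.
- rewrite map_inj_uniq // => R R' /val_inj /addIr; exact.
- by rewrite size_map.
move=> T /mapP [R HR ->]; split; first exact: valP.
by rewrite -val_epointMn mulrnBl !HP // subrr.
Qed.

(** * Affine actions on a torsor of the plane over F_l *)

Lemma inv_mod l i : prime l -> ~~ (l %| i)%N -> exists k j, (k * i = j * l + 1)%N.
Proof.
move=> pl ndv; have i0 : (0 < i)%N by case: i ndv => //; rewrite dvdn0.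
have co : coprime i l by rewrite coprime_sym prime_coprime.
have /(coprimeP _ i0) [[a b] /= H] := co.
by exists a, b; lia.
Qed.

Section Torsor.
Variables (U : zmodType) (gT : finGroupType) (act : gT -> U -> U) (l : nat).
Hypothesis pl : prime l.
Hypothesis actD : forall g, {morph act g : u v / u + v}.
Hypothesis actM : forall g h u, act (g * h)%g u = act h (act g u).
Hypothesis act1 : forall u, act 1%g u = u.
Variable V : seq U.
Hypothesis V_uniq : uniq V.
Hypothesis V_size : size V = (l ^ 2)%N.
Hypothesis V_mem : forall v, (v \in V) = (v *+ l == 0).
Let l1 : (1 < l)%N := prime_gt1 pl.

Lemma act0 g : act g 0 = 0.
Proof. by apply: (addrI (act g 0)); rewrite -actD !addr0. Qed.
Lemma actN g u : act g (- u) = - act g u.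
Proof. by apply: (addrI (act g u)); rewrite -actD !subrr act0. Qed.
Lemma actB g u v : act g (u - v) = act g u - act g v.
Proof. by rewrite actD actN. Qed.
Lemma actMn g u n : act g (u *+ n) = act g u *+ n.
Proof. by elim: n => [|n IH]; rewrite ?mulr0n ?act0 // !mulrS actD IH. Qed.
Lemma actK g u : act (g^-1)%g (act g u) = u.
Proof. by rewrite -actM mulgV act1. Qed.
Lemma actKV g u : act g (act (g^-1)%g u) = u.
Proof. by rewrite -actM mulVg act1. Qed.

Lemma torsion0 : 0 \in V. Proof. by rewrite V_mem mul0rn. Qed.
Lemma torsionD u v : u \in V -> v \in V -> u + v \in V.
Proof. by rewrite !V_mem mulrnDl => /eqP -> /eqP ->; rewrite addr0. Qed.
Lemma torsionN u : u \in V -> - u \in V.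
Proof. by rewrite !V_mem mulNrn => /eqP ->; rewrite oppr0. Qed.
Lemma torsionB u v : u \in V -> v \in V -> u - v \in V.
Proof. by move=> Hu Hv; rewrite torsionD // torsionN. Qed.
Lemma torsionMn u n : u \in V -> u *+ n \in V.
Proof. by rewrite !V_mem mulrnAC => /eqP ->; rewrite mul0rn. Qed.
Lemma torsion_act g u : u \in V -> act g u \in V.
Proof. by rewrite !V_mem -actMn => /eqP ->; rewrite act0. Qed.
Lemma torsion_mul u k : u \in V -> u *+ (k * l) = 0.
Proof. by rewrite V_mem mulnC mulrnA => /eqP ->; rewrite mul0rn. Qed.

Lemma torsion_inv u i : u \in V -> ~~ (l %| i)%N -> exists k, u = u *+ (k * i).
Proof.
move=> Vu /(inv_mod pl) [k [j H]]; exists k.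
by rewrite H mulrnDr torsion_mul // add0r mulr1n.
Qed.

Lemma torsion_dvd u i : u \in V -> u != 0 -> u *+ i = 0 -> (l %| i)%N.
Proof.
move=> Vu u0 H; apply: contraR u0 => /(torsion_inv Vu) [k ->].
by rewrite mulnC mulrnA H mul0rn.
Qed.

Lemma torsion_opp u i : u \in V -> (i <= l)%N -> - (u *+ i) = u *+ (l - i).
Proof.
move=> Vu il; apply: (addrI (u *+ i)); rewrite subrr -mulrnDr subnKC //.
by apply/esym/eqP; rewrite -V_mem.
Qed.

(** The [l ^ 2] combinations with coefficients below [l] are distinct, hence exhaust [V]. *)
Lemma torsion_basis e f : e \in V -> e != 0 -> f \in V -> (forall k, f != e *+ k) ->
  forall v, v \in V -> exists i j, v = e *+ i + f *+ j.
Proof.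
move=> Ve e0 Vf nef v Vv.
pose S := [seq e *+ i + f *+ j | i <- iota 0 l, j <- iota 0 l].
(* The assumption [j <= j'] keeps the subtraction within natural numbers; the other order follows by
   symmetry. *)
have main i j i' j' : (i < l)%N -> (i' < l)%N -> (j' < l)%N -> (j <= j')%N ->
   e *+ i + f *+ j = e *+ i' + f *+ j' -> i = i' /\ j = j'.
  move=> il il' jl' jj H.
  have H1 : f *+ (j' - j) = e *+ (i + (l - i')).
    rewrite mulrnDr -torsion_opp ?(ltnW il') //; apply: (addrI (e *+ i' + f *+ j)).
    by rewrite -addrA -mulrnDr subnKC // -H [RHS]addrC addrA subrK.
  have ej : j = j'.
    apply/eqP; rewrite eqn_leq jj leqNgt; apply/negP => lt.
    have ndv : ~~ (l %| j' - j)%N by rewrite gtnNdvd //; lia.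
    have [k Ek] := torsion_inv Vf ndv; have := nef ((i + (l - i')) * k)%N.
    by rewrite {1}Ek mulnC mulrnA H1 -mulrnA eqxx.
  split=> //; move: H; rewrite ej => /addIr H.
  have [le|le] := leqP i i'.
    have : (l %| i' - i)%N.
      by apply: (torsion_dvd Ve e0); apply: (addrI (e *+ i)); rewrite -mulrnDr subnKC // addr0.
    by case: (posnP (i' - i)) => [|p]; [lia|move/dvdn_leq => /(_ p); lia].
  have : (l %| i - i')%N.
    by apply: (torsion_dvd Ve e0); apply: (addrI (e *+ i')); rewrite -mulrnDr subnKC ?addr0 // ltnW.
  by case: (posnP (i - i')) => [|p]; [lia|move/dvdn_leq => /(_ p); lia].
have US : uniq S.
  apply: allpairs_uniq; rewrite ?iota_uniq // => -[i j] [i' j'].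
  move=> /allpairsP [[a b] [/= Ha Hb [-> ->]]] /allpairsP [[a' b'] [/= Ha' Hb' [-> ->]]] H.
  move: Ha Hb Ha' Hb'; rewrite !mem_iota !add0n => /andP[_ al] /andP[_ bl] /andP[_ al'] /andP[_ bl'].
  have [le|/ltnW le] := leqP b b'.
    by have [-> ->] := main _ _ _ _ al al' bl' le H.
  by have [-> ->] := main _ _ _ _ al' al bl le (esym H).
have SS : size S = (l ^ 2)%N by rewrite size_allpairs size_iota mulnn.
have sub : {subset S <= V}.
  by move=> w /allpairsP [[i j] [_ _ ->]]; rewrite torsionD ?torsionMn.
have [|_ HS] := uniq_min_size US sub; first by rewrite SS V_size.
by move: Vv; rewrite -HS => /allpairsP [[i j] [_ _ ->]]; exists i, j.
Qed.

Hypothesis irr : forall v, v \in V -> v != 0 -> exists g, forall k, act g v != v *+ k.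
Variable R : U.
Hypothesis HR : forall g, act g R - R \in V.

(** Conjugating the translation by [d] with [g] gives the translation by [act g d]; [irr] makes the
    two vectors a basis. *)
Lemma translations_transitive n : (forall v, v \in V -> act n v = v) -> act n R != R ->
  forall v, v \in V -> exists g, act g R = R + v.
Proof.
move=> Hn nR v Vv; pose d := act n R - R.
have Vd : d \in V := HR n.
have d0 : d != 0 by rewrite subr_eq0.
have [g Hg] := irr Vd d0; pose f := act g d.
have Vf : f \in V := torsion_act g Vd.
have trn w : w \in V -> act n (R + w) = R + (w + d).
  move=> Vw; rewrite actD [act n w]Hn // [act n R](_ : _ = R + d); last by rewrite /d addrC subrK.
  by rewrite -addrA [d + w]addrC.
pose n' := (g^-1 * n * g)%g.
have trn' w : w \in V -> act n' (R + w) = R + (w + f).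
  move=> Vw; rewrite /n' !actM.
  set y := act (g^-1)%g (R + w).
  have Vy : y - R \in V.
    by rewrite /y actD addrAC torsionD ?HR ?torsion_act.
  have -> : act n y = y + d by rewrite -{1}[y](subrK R) addrC trn // addrA [R + _]addrC subrK.
  by rewrite actD actKV -/f addrA.
have pow m x : (forall w, w \in V -> act m (R + w) = R + (w + x)) -> x \in V ->
   forall i w, w \in V -> act (m ^+ i)%g (R + w) = R + (w + x *+ i).
  move=> Hm Vx; elim=> [|i IH] w Vw; first by rewrite expg0 act1 mulr0n addr0.
  by rewrite expgS actM Hm // IH ?torsionD // mulrS -addrA.
have [i [j ->]] := torsion_basis Vd d0 Vf Hg Vv.
exists (n ^+ i * n' ^+ j)%g; rewrite actM.
have := pow _ _ trn Vd i 0 torsion0; rewrite addr0 add0r => ->.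
by rewrite (pow _ _ trn' Vf) ?torsionMn.
Qed.

(** [z] reflects the torsor in the point [R + T]. As [-1] is central, the commutator of [z] and [g]
    is trivial on [V], hence on the torsor, so [g] preserves the only fixed point of [z]. *)
Lemma inversion_fixed z : (forall v, v \in V -> act z v = - v) -> odd l ->
  (forall n, (forall v, v \in V -> act n v = v) -> act n R = R) ->
  exists2 v, v \in V & forall g, act g (R + v) = R + v.
Proof.
move=> Hz ol HN; pose d := act z R - R; have Vd : d \in V := HR z.
(* [l./2.+1] is the inverse of 2 modulo the odd [l], so [T] is half of [d]. *)
pose T := d *+ (l./2.+1).
have T2 : T + T = d.
  rewrite /T -mulrnDr; have -> : (l./2.+1 + l./2.+1 = 1 * l + 1)%N.
    by have := odd_double_half l; rewrite ol; lia.
  by rewrite mulrnDr torsion_mul // add0r mulr1n.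
have VT : T \in V by rewrite torsionMn.
have zR : act z (R + T) = R + T.
  by rewrite actD [act z T]Hz // -[act z R](subrK R) -/d -{1}T2 addrAC addrK addrC.
exists T => // g; pose v := act g (R + T) - (R + T).
have Vv : v \in V.
  by rewrite /v actD opprD addrACA torsionD ?HR // torsionB ?torsion_act.
have gRT : act g (R + T) = R + T + v by rewrite /v [RHS]addrC subrK.
pose n := [~ z, g]%g.
have Hn w : w \in V -> act n w = w.
  move=> Vw; rewrite /n /commg /conjg !actM.
  have zi x : x \in V -> act (z^-1)%g x = - x.
    by move=> Vx; rewrite -[x in LHS]opprK -Hz ?actK // torsionN.
  rewrite zi // Hz; last by rewrite torsion_act ?torsionN.
  by rewrite !actN opprK actKV.
have nRT w : w \in V -> act n (R + w) = R + w by move=> Vw; rewrite actD HN // Hn.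
have E : (z * g = g * z * n)%g by rewrite /n /commg /conjg !mulgA mulgK mulgV mul1g.
clearbody n.
have : act (z * g)%g (R + T) = act (g * z * n)%g (R + T) by rewrite E.
rewrite !actM zR gRT [act z _]actD zR (Hz v Vv) -!addrA (nRT _ (torsionB VT Vv)) => /addrI/addrI v2.
have : v *+ 2 = 0 by rewrite mulr2n {1}v2 addNr.
move=> v20; suff -> : v = 0 by rewrite addr0.
apply/eqP; apply: contraT => v0; have := torsion_dvd Vv v0 v20.
by rewrite dvdn_prime2 // => /eqP El; move: ol; rewrite El.
Qed.

Lemma aff_subproof (x : seq_sub V) g : act g (R + val x) - R \in V.
Proof. by rewrite actD addrAC torsionD ?torsion_act //; apply: valP. Qed.
(** The action on [R + V], transported to the finite type of [V] by taking [R] as origin, so that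
    orbits can be counted. *)
Definition aff (x : seq_sub V) (g : gT) : seq_sub V := SeqSub (aff_subproof x g).

Lemma aff1 : aff^~ 1%g =1 id.
Proof. by move=> x; apply: val_inj; rewrite /= act1 addrC addKr. Qed.
Lemma affM x : act_morph aff x.
Proof.
by move=> g h; apply: val_inj; rewrite /= actM; congr (act _ _ - _); rewrite [RHS]addrC subrK.
Qed.
Definition aff_action := TotalAction aff1 affM.
Local Notation A := aff_action.
Let x0 : seq_sub V := SeqSub torsion0.
Local Notation O := (orbit A [set: gT] x0).

Lemma affE x g : val (A x g) = act g (val x) + (act g R - R).
Proof. by rewrite [RHS]addrA -actD [val x + R]addrC. Qed.

(** The affine action permutes the orbit, so [act g] changes its sum by [#|O|] times the translation
    part; [#|O|] is then inverted modulo [l]. *)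
Lemma barycenter_fixed : ~~ (l %| #|O|)%N ->
  exists2 v, v \in V & forall g, act g (R + v) = R + v.
Proof.
move=> ndv; pose S := \sum_(x in O) val x.
have VS : S \in V by apply: (big_ind (fun y => y \in V)) => [||x _]; [exact: torsion0|exact: torsionD|exact: valP].
have actS g : act g S = S - (act g R - R) *+ #|O|.
  have E : S = \sum_(x in O) val (A x g).
    rewrite /S (reindex_inj (act_inj A g)); apply: eq_bigl => x.
    by rewrite orbit_actr ?inE.
  rewrite {2}E -sumr_const -sumrB (big_morph (act g) (actD g) (act0 g)).
  by apply: eq_bigr => x _; rewrite affE addrK.
have [m [j H]] := inv_mod pl ndv.
exists (S *+ m) => [|g]; first exact: torsionMn.
have Vc : act g R - R \in V := HR g.
rewrite actD actMn actS -{1}[act g R](subrK R); move: Vc; set c := act g R - R => Vc.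
have -> : (S - c *+ #|O|) *+ m = S *+ m - c.
  by rewrite mulrnBl -mulrnA mulnC H mulrnDr torsion_mul // add0r mulr1n.
by rewrite addrC addrA subrK addrC.
Qed.

Lemma full_orbit_transitive : #|O| = (l ^ 2)%N ->
  forall v, v \in V -> exists g, act g R = R + v.
Proof.
move=> kO v Vv; have : SeqSub Vv \in O.
  suff -> : O = setT by rewrite inE.
  by apply/eqP; rewrite eqEcard subsetT cardsT card_seq_sub // V_size kO /=.
by case/orbitP => g _ /(congr1 val) /=; rewrite addr0 => <-; exists g; rewrite addrC subrK.
Qed.

Definition ker_act : {set gT} := [set g | all (fun v => act g v == v) V].
Lemma ker_actP g : reflect (forall v, v \in V -> act g v = v) (g \in ker_act).
Proof.
by rewrite inE; apply: (iffP allP) => H v Vv; [apply/eqP/H|apply/eqP/H].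
Qed.

Lemma ker_act_group_set : group_set ker_act.
Proof.
apply/group_setP; split=> [|g h /ker_actP Hg /ker_actP Hh]; apply/ker_actP => v Vv.
  exact: act1.
by rewrite actM Hg ?Hh.
Qed.
Canonical ker_act_group := Group ker_act_group_set.

Lemma ker_act_normal : (ker_act <| [set: gT])%g.
Proof.
rewrite /normal subsetT /=; apply/subsetP => g _; rewrite inE; apply/subsetP => h.
rewrite mem_conjg => /ker_actP Hh; apply/ker_actP => v Vv.
have := Hh (act (g^-1)%g v) (torsion_act _ Vv).
by rewrite /conjg !invgK !actM !actKV => /(congr1 (act g)); rewrite !actKV.
Qed.

(** The kernel fixes [R], so it lies in a stabiliser and [#|O|] divides the order of the quotient;
    Cauchy's theorem applies there. *)
Lemma order_l_elt : (forall n, (forall v, v \in V -> act n v = v) -> act n R = R) ->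
  (l %| #|O|)%N -> exists u, u \notin ker_act /\ (u ^+ l)%g \in ker_act.
Proof.
move=> HN; rewrite card_orbit => dv.
have sN : ker_act \subset ('C_[set: gT][x0 | A])%g.
  apply/subsetP => n /ker_actP Hn; rewrite inE in_setT /=; apply/astab1P/val_inj.
  by rewrite affE /= act0 add0r HN // subrr.
have : (l %| #|([set: gT] / ker_act)%g|)%N.
  rewrite card_quotient ?normal_norm ?ker_act_normal //.
  exact: dvdn_trans dv (indexgS _ sN).
case/(Cauchy pl) => xb /morphimP[u Nu _ ->] ou.
exists u; split.
  apply/negP => uN; move: ou; rewrite /= coset_id // order1 => El.
  by move: l1; rewrite -El.
by apply/coset_idr; rewrite ?groupX // morphX //= -ou expg_order.
Qed.

(** With [D = u - 1], the binomial formula gives [D ^ l = u ^ l - 1 = 0] on [V]. The last two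
    nonzero iterates of [D] on a vector moved by [u] are [f] and [e]. *)
Lemma unipotent_vectors u : u \notin ker_act -> (u ^+ l)%g \in ker_act ->
  exists e f, [/\ e \in V, f \in V, e != 0, act u e = e & act u f = f + e].
Proof.
move=> nu /ker_actP Hl; pose D v := act u v - v.
have DD v w : D (v + w) = D v + D w by rewrite /D actD opprD addrACA.
have D0 : D 0 = 0 by rewrite /D act0 subr0.
have VD' v : v \in V -> D v \in V by move=> Vv; rewrite torsionB ?torsion_act.
have VDn n v : v \in V -> iter n D v \in V by move=> Vv; elim: n => //= n IH; apply: VD'.
have bin n v : act (u ^+ n)%g v = \sum_(i < n.+1) iter i D v *+ 'C(n, i).
  elim: n v => [|n IH] v; first by rewrite expg0 act1 big_ord_recl big_ord0 addr0.
  rewrite expgS actM; have -> : act u v = v + D v by rewrite /D addrC subrK.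
  rewrite actD !IH [in RHS]big_ord_recl /= bin0 mulr1n.
  under [in RHS]eq_bigr => i _ do rewrite /bump /= add1n binS mulrnDr.
  rewrite big_split /= addrA; congr (_ + _); last first.
    by apply: eq_bigr => i _; rewrite -iterSr.
  rewrite big_ord_recl /= bin0 mulr1n; congr (_ + _).
  rewrite [RHS]big_ord_recr /= bin_small // mulr0n addr0.
  by apply: eq_bigr => i _; rewrite /bump /= add1n.
have Dl v : v \in V -> iter l D v = 0.
  move=> Vv; apply: (addrI v); rewrite addr0 -[RHS](Hl _ Vv) bin big_ord_recl /= bin0 mulr1n.
  congr (_ + _); case: l pl V_mem (VDn) => // l' pl' Vm VDn'.
  rewrite big_ord_recr /= /bump /= add1n binn mulr1n big1 ?add0r // => i _.
  rewrite /bump /= add1n; have /dvdnP[k ->] : (l'.+1 %| 'C(l'.+1, i.+1))%N by rewrite prime_dvd_bin //= ltnS ltn_ord.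
  by rewrite mulnC mulrnA; have := VDn' i.+1 v Vv; rewrite Vm => /eqP /= ->; rewrite mul0rn.
have [v Vv nv] : exists2 v, v \in V & act u v != v.
  by move: nu; rewrite inE => /allPn[v Vv nv]; exists v.
have ex : exists i, iter i D v == 0 by exists l; rewrite Dl.
case: (ex_minnP ex) => i /eqP Hi min.
have Dv : D v != 0 by rewrite subr_eq0.
case: i Hi min => [|[|i]] /= Hi min.
- by move: nv; rewrite Hi act0 eqxx.
- by rewrite Hi eqxx in Dv.
exists (D (iter i D v)), (iter i D v); split; try exact: VDn.
- exact: (VDn i.+1).
- by apply/negP => H; have := min i.+1 H; rewrite ltnn.
- by apply/eqP; rewrite -subr_eq0 -/(D _) Hi.
by rewrite /D addrC subrK.
Qed.

(* Two transvections with different axes generate SL_2(F_l). *)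
Lemma inversion_exists u : u \notin ker_act -> (u ^+ l)%g \in ker_act ->
  exists z, forall v, v \in V -> act z v = - v.
Proof.
move=> nu ul; have [e [f1 [Ve Vf1 e0 ue uf1]]] := unipotent_vectors nu ul.
have [g ge] := irr Ve e0; pose f := act g e; pose f2 := act g f1.
have Vf : f \in V := torsion_act g Ve.
have Vf2 : f2 \in V := torsion_act g Vf1.
have act_inj' h x y : act h x = act h y -> x = y.
  by move=> H; rewrite -(actK h x) H actK.
have f0 : f != 0 by apply: contra e0 => /eqP H; apply/eqP/(act_inj' g); rewrite act0.
pose u' := (g^-1 * u * g)%g.
have u'f : act u' f = f by rewrite /u' !actM actK ue.
have u'f2 : act u' f2 = f2 + f by rewrite /u' !actM actK uf1 actD.
have f1e k : f1 != e *+ k.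
  apply/eqP => H; move: uf1; rewrite H actMn ue -[LHS]addr0 => /addrI /esym/eqP.
  by rewrite (negPf e0).
have f2f k : f2 != f *+ k.
  by apply: contra (f1e k) => /eqP H; apply/eqP/(act_inj' g); rewrite actMn.
have [i [j Ef]] := torsion_basis Ve e0 Vf1 f1e Vf.
have [i' [j' Ee]] := torsion_basis Vf f0 Vf2 f2f Ve.
have ndj : ~~ (l %| j)%N.
  apply/negP => /dvdnP[k Ek]; have := ge i; rewrite -/f Ef Ek torsion_mul // addr0 eqxx //.
have ndj' : ~~ (l %| j')%N.
  apply/negP => /dvdnP[k Ek]; move: Ee; rewrite Ek torsion_mul // addr0 => Ee.
  have ndi : ~~ (l %| i')%N.
    by apply/negP => /dvdnP[k' Ek']; move: e0; rewrite Ee Ek' torsion_mul // eqxx.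
  have [m Em] := torsion_inv Vf ndi; have := ge m.
  by rewrite -/f {1}Em mulnC mulrnA -Ee eqxx.
have uf : act u f = f + e *+ j.
  by rewrite {1}Ef actD !actMn ue uf1 mulrnDl addrA -Ef.
have u'e : act u' e = e + f *+ j'.
  by rewrite {1}Ee actD !actMn u'f u'f2 mulrnDl addrA -Ee.
have pow h x y k : act h x = x -> act h y = y + x -> act (h ^+ k)%g y = y + x *+ k.
  move=> hx hy; elim: k => [|k IH]; first by rewrite expg0 act1 addr0.
  by rewrite expgSr actM IH actD actMn hx hy mulrSr -addrA [x + _]addrC.
have fix_ h x k : act h x = x -> act (h ^+ k)%g x = x.
  by move=> hx; elim: k => [|k IH]; rewrite ?expg0 ?act1 // expgS actM hx.
have [k Ek] := torsion_inv Ve ndj.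
have [k' Ek'] := torsion_inv Vf ndj'.
(* [k] and [k'] invert [j] and [j'] modulo [l], and [l.-1] stands for [-1]: in the basis [e], [f]
   these are the elementary matrices with entries 1 and [-1]. *)
pose a := (u ^+ k)%g; pose b := (u' ^+ (k' * l.-1))%g.
have ae : act a e = e by apply: fix_.
have af : act a f = f + e.
  rewrite /a {1}Ek mulnC mulrnA; apply: (pow _ (e *+ j)) => //.
  by rewrite actMn ue.
have bf : act b f = f by apply: fix_.
have be : act b e = e - f.
  have -> : - f = f *+ j' *+ (k' * l.-1).
    by rewrite -mulrnA mulnA [(j' * k')%N]mulnC mulrnA -Ek' -subn1 -torsion_opp // ltnW.
  by apply: pow => //; rewrite actMn u'f.
(* The Weyl element, sending [e] to [- f] and [f] to [e]; its square is [-1]. *)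
pose w := (a * b * a)%g.
have we : act w e = - f.
  by rewrite /w !actM ae be actB ae af opprD addrCA subrr addr0.
have wf : act w f = e.
  by rewrite /w !actM af actD bf be addrC subrK ae.
exists (w * w)%g => v Vv; have [m [n ->]] := torsion_basis Ve e0 Vf ge Vv.
by rewrite actM !actD !actMn we wf actN wf we opprD !mulNrn.
Qed.

Theorem torsor_dichotomy :
  (exists2 v, v \in V & forall g, act g (R + v) = R + v) \/
  (forall v, v \in V -> exists g, act g R = R + v).
Proof.
have [ndv|dv] := boolP (l %| #|O|)%N; last by left; apply: barycenter_fixed.
have [tr|ntr] := classic (forall v, v \in V -> exists g, act g R = R + v); first by right.
have HN n : (forall v, v \in V -> act n v = v) -> act n R = R.
  by move=> Hn; apply/eqP; apply: contraT => nR; case: ntr; apply: translations_transitive Hn nR.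
have [ol|el] := boolP (odd l).
  have [u [nu ul]] := order_l_elt HN ndv.
  have [z Hz] := inversion_exists nu ul.
  by left; apply: inversion_fixed Hz ol HN.
(* The orbit has even size at most 4, and size 4 means transitivity. If it is [{0, x}], every [g]
   permutes it affinely, so [act g x] is the difference of [0] and [x], that is [x], against
   [irr]. *)
have l2 : l = 2%N by apply/eqP; have := even_prime pl; rewrite (negPf el); case => [->|].
have VV : #|{: seq_sub V}| = 4%N by rewrite card_seq_sub // V_size l2.
have O4 : #|O| != 4%N.
  by apply/eqP => H; apply: ntr; apply: full_orbit_transitive; rewrite H l2.
have le4 : (#|O| <= 4)%N by rewrite -VV max_card.
have O2 : #|O| = 2%N.
  have : (0 < #|O|)%N by apply/card_gt0P; exists x0; apply: orbit_refl.
  by move: ndv O4 le4; rewrite l2; case: #|O| => [|[|[|[|[|?]]]]].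
have [x Ox nx] : exists2 x, x \in O & x != x0.
  have /cards2P[x [y [nxy EO]]] : #|O| == 2%N by rewrite O2.
  have [E|n] := eqVneq x x0; last by exists x => //; rewrite EO !inE eqxx.
  by exists y; [rewrite EO !inE eqxx orbT|rewrite -E eq_sym].
have EO : O = [set x0; x].
  apply/esym/eqP; rewrite eqEcard cards2 eq_sym nx O2 andbT.
  by apply/subsetP => y; rewrite !inE => /orP[] /eqP -> //; apply: orbit_refl.
have Vx := valP x; have x0' : val x != 0 by apply: contra nx => /eqP H; apply/eqP/val_inj.
have [g Hg] := irr Vx x0'; case/negP: (Hg 1%N); rewrite mulr1n.
have xx : - val x = val x.
  by apply/eqP; rewrite -subr_eq0 -opprD oppr_eq0 -mulr2n -l2 -V_mem.
have O1 : val (A x0 g) \in [:: 0; val x].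
  by have := mem_orbit A x0 (in_setT g); rewrite EO !inE => /orP[] /eqP ->; rewrite eqxx ?orbT.
have O3 : val (A x g) \in [:: 0; val x].
  by have := orbit_actr A x0 x (in_setT g); rewrite Ox EO !inE => /orP[] /eqP ->; rewrite eqxx ?orbT.
have ne : A x g != A x0 g by rewrite (inj_eq (act_inj A g)).
have -> : act g (val x) = val (A x g) - val (A x0 g).
  by rewrite !affE act0 add0r addrK.
move: O1 O3 ne; rewrite -(inj_eq val_inj) !inE => /orP[] /eqP -> /orP[] /eqP ->;
  rewrite ?eqxx // ?subr0 ?sub0r ?xx ?eqxx //.
Qed.
End Torsor.

(** * Descent *)

(* If [v] is an eigenvector of the companion matrix for [x], then [(v, y v)] is
   an eigenvector of [B] for [y]. *)
Lemma y_annihilator_monic (K : fieldType) (E : wcurve K) (g : {poly K}) : g \is monic -> (1 < size g)%N ->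
  exists2 h : {poly K}, h != 0 & forall (L : fieldType) (i : {rmorphism K -> L}) x y,
   root (map_poly i g) x -> on_curve (wc_map i E) (Some (x, y)) -> root (map_poly i h) y.
Proof.
move=> mg sg; pose M := companionmx g.
pose fM := M *m M *m M + wa2 E *: (M *m M) + wa4 E *: M + (wa6 E)%:M.
pose hM := wa1 E *: M + (wa3 E)%:M.
pose B := block_mx 0 fM 1%:M (- hM).
exists (char_poly B); first exact/monic_neq0/char_poly_monic.
move=> L i x y rx /eqP Hc.
have : eigenvalue (map_mx i M) x.
  by rewrite eigenvalue_root_char -map_char_poly companionmxK.
move=> /eigenvalueP [v Hv v0].
rewrite map_char_poly -eigenvalue_root_char; apply/eigenvalueP.
exists (row_mx v (y *: v)); last by apply: contra v0 => /eqP; rewrite -row_mx0 => /eq_row_mx [-> _].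
rewrite map_block_mx map_mx0 map_mx1 mul_row_block mulmx0 add0r mulmx1 scale_row_mx; congr row_mx.
rewrite map_mxN mulmxN /fM /hM !map_mxD !map_mxZ !map_mxM /= !map_scalar_mx.
rewrite !mulmxDr !mulmxA -!scalemxAr !mul_mx_scalar !Hv -?scalemxAl !Hv -?scalemxAl !Hv.
rewrite mulmxA Hv -scalemxAl Hv !scalerA -!scalerDl.
apply/eqP; rewrite subr_eq -scalerDl; apply/eqP; congr (_ *: _).
transitivity (x ^+ 3 + i (wa2 E) * x ^+ 2 + i (wa4 E) * x + i (wa6 E)); first by ring.
by rewrite /= in Hc; rewrite -Hc; ring.
Qed.

Lemma y_annihilator (K : fieldType) (E : wcurve K) (g : {poly K}) : (1 < size g)%N ->
  exists2 h : {poly K}, h != 0 & forall (L : fieldType) (i : {rmorphism K -> L}) x y,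
   root (map_poly i g) x -> on_curve (wc_map i E) (Some (x, y)) -> root (map_poly i h) y.
Proof.
move=> sg; have g0 : lead_coef g != 0 by rewrite lead_coef_eq0 -size_poly_gt0 ltnW.
have [||h h0 H] := @y_annihilator_monic K E ((lead_coef g)^-1 *: g).
- by rewrite monicE lead_coefZ mulVf.
- by rewrite size_scale ?invr_eq0.
exists h => // L i x y rx; apply: H.
by rewrite map_polyZ rootZ // fmorph_eq0 invr_eq0.
Qed.

(* Purely inseparable elements are excluded by the simple roots of p. *)
Lemma fixed_root_rational (K : fieldType) (L : splittingFieldType K) (p : {poly K}) (rs : seq L) a :
  uniq rs -> map_poly (in_alg L) p %= \prod_(r <- rs) ('X - r%:P) -> a \in rs ->
  (forall s : gal_of (fullv : {vspace L}), s a = a) -> exists k : K, a = k%:A.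
Proof.
move=> Urs Hp ars fix_a.
have pa : root (map_poly (in_alg L) p) a by rewrite (eqp_root Hp) root_prod_XsubC.
have pO : map_poly (in_alg L) p \is a polyOver 1%AS.
  by apply/polyOverP => i; rewrite coef_map memvZ ?mem1v.
have dv := minPoly_dvdp pO pa.
have [r /eqP Hr] := splitting_field_normal 1%AS a.
have ra b : b \in r -> b = a.
  move=> br; have rb : root (minPoly 1 a) b by rewrite Hr root_prod_XsubC.
  have [x _ <-] := normalField_root_minPoly (sub1v {:L}) (normalFieldf 1%AS) (memvf a) rb.
  by rewrite fix_a.
have Ur : uniq r.
  by rewrite -separable_prod_XsubC -Hr; apply: dvdp_separable dv _; rewrite (eqp_separable Hp) separable_prod_XsubC.
have Er : r = [:: a].
  have : a \in r by rewrite -root_prod_XsubC -Hr root_minPoly.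
  case: r ra Ur {Hr} => [|b [|c r]] ra Ur //.
    by rewrite inE => /eqP ->.
  by have := Ur; rewrite /= (ra b) ?mem_head // (ra c) ?inE ?eqxx ?orbT.
have /vlineP [k Ek] : a \in 1%VS.
  have : (minPoly 1 a)`_0 \in 1%VS by apply/polyOverP/minPolyOver.
  by rewrite Hr Er big_seq1 coefB coefX coefC /= sub0r rpredN.
by exists k.
Qed.

(** * Galois action on points *)

Section PointMap.
Variables (K L : fieldType) (g : {rmorphism K -> L}) (E : wcurve K).
Local Notation gE := (wc_map g E).

Definition ptmap (P : option (K * K)) : option (L * L) := omap (fun p => (g p.1, g p.2)) P.

Lemma ptmap_inj : injective ptmap.
Proof. by move=> [[x y]|] [[x' y']|] //= [/fmorph_inj -> /fmorph_inj ->]. Qed.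

Lemma on_curve_map P : on_curve gE (ptmap P) = on_curve E P.
Proof.
case: P => [[x y]|] //=.
by rewrite -(inj_eq (fmorph_inj g)) !(rmorphXn, rmorphD, rmorphM).
Qed.

Lemma opppt_map P : opppt gE (ptmap P) = ptmap (opppt E P).
Proof. by case: P => [[x y]|] //=; rewrite !(rmorphN, rmorphD, rmorphM). Qed.

Lemma addpt_map P Q : addpt gE (ptmap P) (ptmap Q) = ptmap (addpt E P Q).
Proof.
case: P Q => [[x y]|] [[x' y']|] //; rewrite /addpt /=.
have -> : (g x == g x') = (x == x') by rewrite (inj_eq (fmorph_inj g)).
have -> : (g y + g y' + g (wa1 E) * g x' + g (wa3 E) == 0) = (y + y' + wa1 E * x' + wa3 E == 0).
  by rewrite -(fmorph_eq0 g) !(rmorphD, rmorphM).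
case: (_ && _) => //=; case: (x == x') => /=;
by rewrite !(rmorph_nat, fmorphV, rmorphXn, rmorphN, rmorphD, rmorphM).
Qed.

Lemma mulpt_map n P : mulpt gE n (ptmap P) = ptmap (mulpt E n P).
Proof. by elim: n => //= n IH; rewrite IH addpt_map. Qed.
End PointMap.

Lemma delta_map (K L : fieldType) (g : {rmorphism K -> L}) (E : wcurve K) l P :
  map_poly g (delta E l P) = delta (wc_map g E) l (ptmap g P).
Proof.
case: P => [[x y]|] /=; last exact: psi_sq_map.
by rewrite rmorphB /= map_polyZ theta_map psi_sq_map.
Qed.

Section GaloisAction.
Variables (K : fieldType) (E : wcurve K) (L : splittingFieldType K).
Local Notation EL := (wc_map (in_alg L) E).
Hypothesis hE : is_elliptic EL.

Lemma gal_alg (s : gal_of (fullv : {vspace L})) k : s k%:A = k%:A.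
Proof. by rewrite rmorph_alg. Qed.

Lemma gal_curve (s : gal_of (fullv : {vspace L})) : wc_map s EL = EL.
Proof. by case: E => a b c d e; rewrite /wc_map /= !gal_alg. Qed.

Lemma gal_act_subproof (s : gal_of (fullv : {vspace L})) (P : epoint hE) :
  on_curve EL (map_pt s (val P)).
Proof.
by rewrite -{1}(gal_curve s) -[map_pt s _]/(ptmap s (val P)) on_curve_map; apply: valP.
Qed.
Definition gal_act s (P : epoint hE) : epoint hE := exist (fun P => on_curve EL P) _ (gal_act_subproof s P).

Lemma gal_actD s : {morph gal_act s : P Q / P + Q}.
Proof.
move=> P Q; apply: val_inj; rewrite !val_epointD /= -[map_pt s _]/(ptmap s _).
by rewrite -addpt_map gal_curve.
Qed.
Lemma gal_actM s t P : gal_act (s * t)%g P = gal_act t (gal_act s P).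
Proof.
apply: val_inj => /=; case: (val P) => [[x y]|] //=.
by rewrite /map_pt /= !galM ?memvf.
Qed.
Lemma gal_act1 P : gal_act 1%g P = P.
Proof. by apply: val_inj => /=; case: (val P) => [[x y]|] //=; rewrite /map_pt /= !gal_id. Qed.
End GaloisAction.

(** * Solutions of [l R = P] when [P] differs from [- P] *)

Section MainCase.
Variables (K : fieldType) (E : wcurve K) (hE : is_elliptic E) (l : nat) (P : pt K).
Hypotheses (pl : prime l) (l0 : (l%:R : K) != 0) (HP : on_curve E P) (P0 : P != None).
Hypothesis P2 : opppt E P != P.
Let l_gt0 : (0 < l)%N := prime_gt0 pl.
Let dlt := delta E l P.

Lemma size_delta : size dlt = (l ^ 2).+1.
Proof. exact: lead_at_size (lead_delta E l_gt0 P0) (oner_neq0 _). Qed.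

Section InExtension.
Variable L : splittingFieldType K.
Local Notation EL := (wc_map (in_alg L) E).
Hypothesis hL : is_elliptic EL.
Local Notation U := (epoint hL).

Definition PL : U := exist (fun P => on_curve EL P) (ptmap (in_alg L) P)
  (etrans (on_curve_map (in_alg L) E P) HP).

Definition xc (S : U) : L := (px (val S)).1.

Lemma PL_opp : - PL != PL.
Proof.
apply: contra P2 => /eqP /(congr1 val); rewrite val_epointN /= opppt_map.
by move=> /ptmap_inj ->.
Qed.

(** Equal abscissae give [T = S] or [T = - S], and the latter would give [P = - P]. *)
Lemma xc_inj S T : S *+ l = PL -> T *+ l = PL -> xc S = xc T -> S = T.
Proof.
move=> HS HT Ex; have [//|ST] : S = T \/ T = - S.
  have S0 : val S != None.
    apply: contra P0 => /eqP HS0; have : S = 0 by apply: val_inj.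
    move=> S00; move: HS; rewrite S00 mul0rn => /(congr1 val) /=.
    by case: (P).
  have T0 : val T != None.
    apply: contra P0 => /eqP HS0; have : T = 0 by apply: val_inj.
    move=> S00; move: HT; rewrite S00 mul0rn => /(congr1 val) /=.
    by case: (P).
  move: Ex S0 T0; rewrite /xc.
  have := valP S; have := valP T.
  case ES: (val S) => [[x y]|] //; case ET: (val T) => [[x' y']|] //= cT cS Ex _ _.
  rewrite -Ex in ET cT; case: (@same_x _ EL _ _ _ cS cT) => Ey; [left|right]; apply: val_inj.
    by rewrite ES ET Ey.
  by rewrite val_epointN ES ET Ey.
by move: HT; rewrite ST mulNrn HS => /eqP; rewrite (negPf PL_opp).
Qed.

Lemma root_delta_point S : S *+ l = PL -> root (map_poly (in_alg L) dlt) (xc S).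
Proof.
move=> HS; have S0 : val S != None.
  apply: contra P0 => /eqP HS0; have S00 : S = 0 by apply: val_inj.
  by move: HS; rewrite S00 mul0rn => /(congr1 val) /=; case: (P).
rewrite /dlt delta_map /xc; have := valP S.
case ES: (val S) S0 => [[x y]|] // _ cS /=.
have PL0 : val PL != None by rewrite /=; case: (P) P0.
apply/(root_delta hL l_gt0 cS (valP PL) PL0); left.
by rewrite -ES -val_epointMn HS.
Qed.

(** The points [S + T] have distinct abscissae, all roots of [delta], whose degree is [l ^ 2]. *)
Lemma torsion_bound (s : seq U) S : S *+ l = PL -> uniq s -> (forall T, T \in s -> T *+ l = 0) ->
  (size s <= l ^ 2)%N.
Proof.
move=> HS Us Ts; rewrite -ltnS -size_delta -(size_map_poly (in_alg L)).
rewrite -(size_map (fun T => xc (S + T))); apply: max_poly_roots.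
- by rewrite map_poly_eq0 -size_poly_gt0 size_delta.
- apply/allP => _ /mapP[T Tin ->]; apply: root_delta_point.
  by rewrite mulrnDl HS Ts ?addr0.
rewrite map_inj_in_uniq // => T T' Tin T'in H.
by apply: (addrI S); apply: xc_inj H; rewrite mulrnDl HS Ts ?addr0.
Qed.

Variable V : seq U.
Hypotheses (V_uniq : uniq V) (V_size : size V = (l ^ 2)%N).
Hypothesis V_mem : forall v, (v \in V) = (v *+ l == 0).
Variable R : U.
Hypothesis HR : R *+ l = PL.

Let rts := [seq xc (R + v) | v <- V].

Lemma translate_mul v : v \in V -> (R + v) *+ l = PL.
Proof. by rewrite V_mem mulrnDl HR => /eqP ->; rewrite addr0. Qed.

Lemma uniq_fiber_x : uniq rts.
Proof.
rewrite map_inj_in_uniq // => v w Vv Vw H.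
by apply: (addrI R); apply: xc_inj H; apply: translate_mul.
Qed.

Lemma delta_split : map_poly (in_alg L) dlt %= \prod_(r <- rts) ('X - r%:P).
Proof.
rewrite (@all_roots_prod_XsubC _ (map_poly (in_alg L) dlt) rts).
- by rewrite eqp_scale // lead_coef_eq0 map_poly_eq0 -size_poly_gt0 size_delta.
- by rewrite size_map_poly size_delta size_map V_size.
- by apply/allP => _ /mapP[v Vv ->]; apply/root_delta_point/translate_mul.
by rewrite uniq_rootsE uniq_fiber_x.
Qed.

Lemma gal_actMn s S n : gal_act s S *+ n = gal_act s (S *+ n) :> U.
Proof.
by elim: n => [|n IH]; rewrite ?mulrS ?gal_actD ?IH //; apply: val_inj.
Qed.

Lemma gal_act_PL s : gal_act s PL = PL.
Proof.
by apply: val_inj => /=; case: (P) => [[x y]|] //=; rewrite /map_pt /= !gal_alg.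
Qed.

Lemma gal_act_R s : gal_act s R - R \in V.
Proof. by rewrite V_mem mulrnBl gal_actMn HR gal_act_PL subrr. Qed.

(** The abscissa is a simple root of [delta]. Once it is rational, the ordinate is a root of a
    quadratic whose roots differ because [S != - S]. *)
Lemma fixed_point_descent v : v \in V -> (forall s, gal_act s (R + v) = R + v) ->
  exists Q : pt K, on_curve E Q /\ mulpt E l Q = P.
Proof.
move=> Vv fixS; set S := R + v in fixS; have HS : S *+ l = PL := translate_mul Vv.
have nS : - S != S.
  by apply: contra PL_opp => /eqP H; rewrite -HS -mulNrn H.
have xin : xc S \in rts by apply/mapP; exists v.
have cS := valP S; case ES: (val S) cS nS => [[x y]|] cS nS; last first.
  have S0 : S = 0 by apply: val_inj.
  by move: nS; rewrite S0 oppr0 eqxx.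
have fixxy (s : gal_of (fullv : {vspace L})) : s x = x /\ s y = y.
  by have : map_pt s (val S) = val S := congr1 val (fixS s); rewrite ES => -[].
have [k Ek] : exists k : K, xc S = k%:A.
  apply: (fixed_root_rational uniq_fiber_x delta_split xin) => s.
  by rewrite /xc ES; have [] := fixxy s.
rewrite /xc ES /= in Ek; pose y' := - y - wa1 EL * x - wa3 EL.
have [k' Ek'] : exists k : K, y = k%:A.
  have cE : on_curve EL (Some (in_alg L k, y)) by rewrite -[in_alg L k]Ek.
  apply: (@fixed_root_rational K L (ypoly E k) [:: y; y']); last by move=> s; have [] := fixxy s.
  - rewrite /= andbT inE; apply: contra nS => /eqP yy; apply/eqP/val_inj.
    by rewrite val_epointN ES /= -/y' -yy.
  - rewrite ypoly_map (@all_roots_prod_XsubC _ (ypoly EL (in_alg L k)) [:: y; y']) ?size_ypoly //.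
    + by rewrite eqp_scale // lead_coef_eq0 ypoly_neq0.
    + rewrite /= !root_ypoly cE /= andbT.
      by have := on_curve_opp cE; rewrite /opppt /y' Ek.
    rewrite uniq_rootsE /= andbT inE; apply: contra nS => /eqP yy; apply/eqP/val_inj.
    by rewrite val_epointN ES /= -/y' -yy.
  by rewrite mem_head.
have ESk : val S = ptmap (in_alg L) (Some (k, k')) by rewrite ES /= Ek Ek'.
exists (Some (k, k')); split.
  by rewrite -(on_curve_map (in_alg L)) -ESk; apply: valP.
apply: (@ptmap_inj _ _ (in_alg L)); rewrite -mulpt_map -ESk.
by rewrite -val_epointMn HS.
Qed.

(** A nonzero polynomial over [K] vanishing at [xc R] vanishes at its [l ^ 2] distinct conjugates.
    In a factorisation one factor does, so it has the full degree. *)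
Lemma transitive_irreducible : (forall v, v \in V -> exists s, gal_act s R = R + v) ->
  irreducible_poly dlt.
Proof.
move=> tr.
have big (d : {poly K}) : d != 0 -> root (map_poly (in_alg L) d) (xc R) -> ((l ^ 2).+1 <= size d)%N.
  move=> d0 rd; rewrite -(size_map_poly (in_alg L)) -V_size -(size_map (fun v => xc (R + v))).
  apply: max_poly_roots; rewrite ?map_poly_eq0 ?uniq_fiber_x //.
  apply/allP => _ /mapP[v Vv ->]; have [s <-] := tr v Vv.
  have -> : xc (gal_act s R) = s (xc R).
    by rewrite /xc /=; case: (val R) => [[x y]|] //=; rewrite rmorph1.
  have -> : map_poly (in_alg L) d = map_poly s (map_poly (in_alg L) d).
    by rewrite -map_poly_comp; apply: eq_map_poly => a /=; rewrite gal_alg.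
  exact: rmorph_root.
have dlt0 : dlt != 0 by rewrite -size_poly_gt0 size_delta.
split; first by rewrite size_delta ltnS expn_gt0 l_gt0.
move=> q q1 qd; have := qd => /dvdpP[e Ee].
have [e0 q0] : e != 0 /\ q != 0 by apply/andP; rewrite -negb_or -mulf_eq0 -Ee.
have sE : ((l ^ 2).+1 = (size e + size q).-1)%N by rewrite -size_delta Ee size_mul.
have : root (map_poly (in_alg L) (e * q)) (xc R) by rewrite -Ee root_delta_point.
rewrite rmorphM rootM => /orP[/(big _ e0)|/(big _ q0)] le.
  have s0 : (0 < size q)%N by rewrite size_poly_gt0.
  by move: q1 le s0 sE; move: (size q) (size e) (l ^ 2)%N; clear => a b c; lia.
by rewrite -dvdp_size_eqp // eqn_leq dvdp_leq // size_delta.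
Qed.

Lemma extension_trichotomy :
  [\/ irreducible_poly dlt, has_gal_stable_cyclic E l
    | exists Q : pt K, on_curve E Q /\ mulpt E l Q = P].
Proof.
have [[v [Vv v0 st]]|nst] := classic (exists v : U, [/\ v \in V, v != 0 &
    forall s : gal_of (fullv : {vspace L}), exists k, gal_act s v = v *+ k]).
  apply: Or32; exists L, (val v); split.
  - exact: valP.
  - by apply: contra v0 => /eqP H; apply/eqP/val_inj.
  - by rewrite -val_epointMn; move: Vv; rewrite V_mem => /eqP ->.
  by move=> s; have [k Hk] := st s; exists k; rewrite -val_epointMn -Hk.
have irr v : v \in V -> v != 0 -> exists s, forall k, gal_act s v != v *+ k.
  move=> Vv v0; apply: NNPP => H; apply: nst; exists v; split=> // s.
  apply: NNPP => H'; apply: H; exists s => k; apply/eqP => H''; apply: H'.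
  by exists k.
have [[v Vv fix_v]|tr] := torsor_dichotomy pl (@gal_actD _ _ _ hL) (@gal_actM _ _ _ hL)
   (@gal_act1 _ _ _ hL) V_uniq V_size V_mem irr gal_act_R.
  by apply: Or33; apply: fixed_point_descent Vv fix_v.
by apply: Or31; apply: transitive_irreducible.
Qed.
End InExtension.
End MainCase.

(** * The point at infinity and points of order two *)

Lemma mulpt_None (K : fieldType) (E : wcurve K) n : mulpt E n None = None.
Proof. by elim: n => //= n ->. Qed.

Lemma two_torsion_case (K : fieldType) (E : wcurve K) (l : nat) (P : pt K) :
  prime l -> is_elliptic E -> on_curve E P -> P != None -> opppt E P = P ->
  has_gal_stable_cyclic E l \/ exists Q : pt K, on_curve E Q /\ mulpt E l Q = P.
Proof.
move=> pl hE HP P0 P2; pose T : epoint hE := exist (fun P => on_curve E P) P HP.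
have T2 : T *+ 2 = 0.
  by rewrite mulr2n -{1}[T]opprK (_ : - T = T) ?addNr //; apply: val_inj.
have [ol|el] := boolP (odd l); [right|left].
  exists P; split=> //; have := val_epointMn T l; rewrite -[val T]/P => <-.
  by rewrite -(odd_double_half l) ol mulrnDr -mul2n mulrnA T2 mul0rn addr0.
have l2 : l = 2%N by have := even_prime pl; rewrite (negPf el); case => [->|].
(* [P] is already rational, so the trivial extension serves. *)
pose L : splittingFieldType K := K^o.
exists L, (ptmap (in_alg L) P); split.
- by rewrite on_curve_map.
- by apply: contra P0; case: (P) => [[]|].
- by rewrite l2 mulpt_map -[P]/(val T) -val_epointMn T2.
move=> s; exists 1%N; rewrite /= addpt0; case: (P) => [[x y]|] //=.
by rewrite /map_pt /= !gal_alg.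
Qed.

(** * The field of division points *)

Section Construction.
Variables (K : fieldType) (E : wcurve K) (hE : is_elliptic E) (l : nat) (P : pt K).
Hypotheses (pl : prime l) (l0 : (l%:R : K) != 0) (HP : on_curve E P) (P0 : P != None).
Let l_gt0 : (0 < l)%N := prime_gt0 pl.
Let dlt := delta E l P.

Lemma size_psi_sq : size (psi_sq E l) = (l ^ 2)%N.
Proof.
rewrite (lead_at_size (lead_psi_sq E l_gt0)) ?expf_neq0 //.
by rewrite subn1 prednK // expn_gt0 l_gt0.
Qed.

(* A normal extension over which all solutions of l R = P and l T = 0 are defined. *)
Lemma division_field : exists L : splittingFieldType K,
  (exists z : L, root (map_poly (in_alg L) dlt) z) /\
  forall (M : fieldType) (i : {rmorphism L -> M}) x y, 
    root (map_poly i (map_poly (in_alg L) (psi_sq E l * dlt))) x ->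
    on_curve (wc_map i (wc_map (in_alg L) E)) (Some (x, y)) ->
    exists T : option (L * L), Some (x, y) = ptmap i T.
Proof.
have q0 : psi_sq E l != 0 by rewrite -size_poly_gt0 size_psi_sq expn_gt0 l_gt0.
have d0 : dlt != 0 by rewrite -size_poly_gt0 (size_delta E pl P0).
have d1 : (1 < size dlt)%N by rewrite (size_delta E pl P0) ltnS expn_gt0 l_gt0.
(* [h] vanishes at the ordinates of all points whose abscissa is a root of [psi_sq E l * dlt], so
   splitting it as well makes these points rational over [L]. *)
have [|h h0 Hh] := @y_annihilator K E (psi_sq E l * dlt).
  apply: leq_trans d1 _; rewrite size_mul // (_ : size (psi_sq E l) = (size (psi_sq E l)).-1.+1).
    by rewrite addSn /= leq_addl.
  by rewrite prednK // size_poly_gt0.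
have [|L [zs Hzs]] := @splitting_field_exists K (psi_sq E l * dlt * h).
  by rewrite !mulf_neq0.
exists L; split.
  have [||z rz _] := @split_root L (map_poly (in_alg L) dlt) zs.
  - by rewrite -(eqp_dvdr _ Hzs) dvdp_map mulrAC dvdp_mull.
  - by rewrite size_map_poly.
  by exists z.
move=> M i x y rx Hc.
have img (p : {poly K}) w : p %| psi_sq E l * dlt * h ->
    root (map_poly i (map_poly (in_alg L) p)) w -> exists w', w = i w'.
  move=> dv rw; have : root (map_poly i (\prod_(z <- zs) ('X - z%:P))) w.
    move: rw; rewrite !root_factor_theorem => /dvdp_trans; apply.
    by rewrite dvdp_map -(eqp_dvdr _ Hzs) dvdp_map.
  rewrite map_prod_XsubC -(big_map i xpredT (fun z => 'X - z%:P)) root_prod_XsubC.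
  by case/mapP => w' _ ->; exists w'.
have [x' ->] := img _ _ (dvdp_mulr _ (dvdpp _)) rx.
have ry : root (map_poly i (map_poly (in_alg L) h)) y.
  by rewrite -map_poly_comp; apply: (Hh M (i \o in_alg L) x y); rewrite // map_poly_comp.
have [y' ->] := img _ _ (dvdp_mull _ (dvdpp _)) ry.
by exists (Some (x', y')).
Qed.

(** One solution [R] and the [l ^ 2] torsion points are found over extensions [M] of [L]; [lift]
    shows that they already live over [L]. *)
Lemma division_points : opppt E P != P ->
  [\/ irreducible_poly dlt, has_gal_stable_cyclic E l
    | exists Q : pt K, on_curve E Q /\ mulpt E l Q = P].
Proof.
move=> P2; have [L [[z rz] lift]] := division_field.
pose EL := wc_map (in_alg L) E; have hL : is_elliptic EL by rewrite is_elliptic_map.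
pose PP := PL HP hL.
have [R HR] : exists R : epoint hL, R *+ l = PP.
  have [M [i [y cM]]] := point_ext EL z.
  have [|T HT] := lift M i (i z) y _ cM.
    by rewrite rmorphM !rmorphM rootM !fmorph_root rz orbT.
  have cT : on_curve EL T by rewrite -(on_curve_map i) -HT.
  pose T' : epoint hL := exist (fun P => on_curve EL P) T cT.
  have PP0 : val PP != None by rewrite /=; case: (P) P0.
  move: HT cT @T' => HT; case: T HT => [[x' y']|] // [/fmorph_inj <- _] cT T'.
  rewrite /dlt delta_map in rz.
  have [H|H] := (root_delta hL l_gt0 cT (valP PP) PP0).1 rz.
    by exists T'; apply: val_inj; rewrite val_epointMn.
  exists (- T'); rewrite mulNrn; apply: (can_inj opprK); rewrite opprK.
  by apply: val_inj; rewrite val_epointMn.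
have [M [i [s [Us Ss Hs]]]] := torsion_ext hL (prime_gt1 pl) (natf_map (in_alg L) l0).
have [V [Vs Vl]] : exists V : seq (epoint hL), map (fun T => ptmap i (val T)) V = s /\
    forall T, T \in V -> T *+ l = 0.
  elim: s Hs {Us Ss} => [|T s IH] Hs; first by exists [::].
  have [V [Vs Vl]] : exists V : seq (epoint hL), map (fun T => ptmap i (val T)) V = s /\
    forall T, T \in V -> T *+ l = 0 by apply: IH => T' Ts; apply: Hs; rewrite inE Ts orbT.
  have [cT lT] := Hs T (mem_head _ _).
  have [T' ET] : exists T' : option (L * L), T = ptmap i T'.
    case: T cT lT {Hs} => [[x y]|] cT lT; last by exists None.
    apply: lift => //; rewrite rmorphM rmorphM rootM; apply/orP; left.
    rewrite /= psi_sq_map psi_sq_map.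
    by rewrite (root_psi_sq (E := wc_map i EL) _ l_gt0 cT) ?lT ?is_elliptic_map.
  have cT' : on_curve EL T' by rewrite -(on_curve_map i) -ET.
  pose T0 : epoint hL := exist (fun P => on_curve EL P) T' cT'.
  exists (T0 :: V); split; first by rewrite /= Vs ET.
  move=> T1; rewrite inE => /orP[/eqP ->|]; last exact: Vl.
  apply: val_inj; rewrite val_epointMn; apply: (@ptmap_inj _ _ i).
  by rewrite -mulpt_map -ET lT.
have UV : uniq V by apply: (@map_uniq _ _ (fun T => ptmap i (val T))); rewrite Vs.
have SV : size V = (l ^ 2)%N by rewrite -Ss -Vs size_map.
(* A further torsion point would exceed the bound [l ^ 2] of [torsion_bound], so [V] is all of the
   [l]-torsion over [L]. *)
have V_mem v : (v \in V) = (v *+ l == 0).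
  apply/idP/idP => [/Vl -> //|/eqP vl]; apply: contraT => nv.
  have := @torsion_bound _ _ _ _ pl HP P0 P2 L hL (v :: V) R HR.
  rewrite /= nv UV SV ltnn; apply=> // T; rewrite inE => /orP[/eqP -> //|]; exact: Vl.
exact: (extension_trichotomy pl P0 P2 UV SV V_mem HR).
Qed.
End Construction.

Theorem theorem1p2 (K : fieldType) (E : wcurve K) (l : nat) (P : pt K) :
  prime l -> is_elliptic E -> (l%:R : K) != 0 -> on_curve E P ->
  [\/ irreducible_poly (delta E l P),
      has_gal_stable_cyclic E l
    | exists Q : pt K, on_curve E Q /\ mulpt E l Q = P].
Proof.
move=> pl hE l0 HP; have [->|P0] := eqVneq P None.
  by apply: Or33; exists None; rewrite mulpt_None.
have [P2|P2] := eqVneq (opppt E P) P.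
  by have [] := two_torsion_case pl hE HP P0 P2; [apply: Or32|apply: Or33].
exact: division_points.
Qed.
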